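(* Let $K$ and $M$ be simplicial complexes with disjoint vertex sets, with face posets $P_K$ and $P_M$, and let $\tilde{R} \subseteq P_K \times P_M$ be a relation between the face posets. Let $K \star_{\tilde{R}} M$ and $K \times_{\tilde{R}} M$ denote the relational join complex and the relational product complex. Fix an abelian group $G$ and let $H_n(-)$ denote homology with coefficients in $G$. Then there exists a long exact sequence $$\cdots \to H_n(K \times_{\tilde{R}} M) \to H_n(K) \oplus H_n(M) \to H_n(K \star_{\tilde{R}} M) \to H_{n-1}(K \times_{\tilde{R}} M) \to \cdots .$$
   Context: The face poset $P_K$ of a simplicial complex $K$ is the set of its (non-empty) simplices ordered by inclusion; $\|K\|$ is the geometric realization, and the homology of a simplicial complex is that of its realization. A relation between posets $P$ and $Q$ is a downward closed subset $\tilde{R} \subseteq P \times Q$ (for the product order); write $p\tilde{R}q$ for $(p,q)\in\tilde{R}$. The relational join complex is the abstract simplicial complex $$K \star_{\tilde{R}} M = K \cup M \cup \{\sigma_K \cup \sigma_M \mid \sigma_K \tilde{R} \sigma_M\}.$$ The relational product complex is the regular CW complex $$K \times_{\tilde{R}} M = \bigcup_{\sigma \tilde{R} \tau} \|\sigma\| \times \|\tau\|,$$ a subcomplex of $\|K\| \times \|M\|$, where the product carries the compactly generated CW topology (the weak topology with respect to the closed cells $\|\sigma\| \times \|\tau\|$). *)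

(* Defs.v *)
From HB Require Import structures.
From mathcomp Require Import all_boot all_order all_algebra finmap.
From mathcomp Require Import all_classical all_reals all_analysis.
(* The notations of monalg clash with those of mathcomp-analysis. *)
From mathcomp Require monalg.
Import -(notations) monalg.

Set Implicit Arguments.
Unset Strict Implicit.
Unset Printing Implicit Defensive.

Import Order.TTheory GRing.Theory Num.Theory.
Import numFieldNormedType.Exports.

Local Open Scope classical_set_scope.
Local Open Scope ring_scope.

(* Possibly infinite; not every element of [T] need be a vertex. *)
Record simplicial_complex (T : choiceType) := SimplicialComplex {
  simplices :> set {fset T};
  simplex_neq0 : forall s, simplices s -> s != fset0;
  simplex_sub : forall s t : {fset T},
    simplices s -> (t `<=` s)%fset -> t != fset0 -> simplices t }.

Definition vertices (T : choiceType) (K : simplicial_complex T) : set T :=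
  [set v | simplices K [fset v]%fset].

Definition face_poset (T : choiceType) (K : simplicial_complex T) : Type :=
  set_type K.

Fact face_display : Order.disp_t. Proof. exact: Order.Disp tt tt. Qed.

Section FacePoset.
Variables (T : choiceType) (K : simplicial_complex T).

HB.instance Definition _ := Choice.on (face_poset K).
HB.instance Definition _ := SubType.on (face_poset K).

Definition le_face (s t : face_poset K) : bool := (val s `<=` val t)%fset.

Let le_face_refl : reflexive le_face.
Proof. by move=> s; exact: fsubset_refl. Qed.

Let le_face_anti : antisymmetric le_face.
Proof.
by move=> s t /andP[st ts]; apply/val_inj/eqP; rewrite eqEfsubset; apply/andP.
Qed.

Let le_face_trans : transitive le_face.
Proof. by move=> t s u; exact: fsubset_trans. Qed.

HB.instance Definition _ := Order.Le_isPOrder.Build face_display (face_poset K)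
  le_face_refl le_face_anti le_face_trans.

End FacePoset.

(* A downward closed subset for the product order. *)
Record poset_relation d d' (P : porderType d) (Q : porderType d') :=
  PosetRelation {
    related :> set (P * Q);
    related_down : forall p p' q q',
      related (p, q) -> (p' <= p)%O -> (q' <= q)%O -> related (p', q') }.

Section Join.
Variables (T : choiceType) (K M : simplicial_complex T).
Variable S : poset_relation (face_poset K) (face_poset M).

Definition join_simplices : set {fset T} :=
  K `|` M `|` [set (val p.1 `|` val p.2)%fset | p in S].

Let join_neq0 s : join_simplices s -> s != fset0.
Proof.
move=> [[|]|]; try exact: simplex_neq0.
move=> [[a b] _ <-] /=; rewrite fsetU_eq0 negb_and.
by rewrite (simplex_neq0 (set_mem (valP a))).
Qed.

Let join_sub s t : join_simplices s -> (t `<=` s)%fset -> t != fset0 ->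
  join_simplices t.
Proof.
move=> [[Ks|Ms]|[[a b] Sab <-]] /= ts t0.
- by left; left; exact: simplex_sub Ks ts t0.
- by left; right; exact: simplex_sub Ms ts t0.
have tE : t = ((t `&` val a) `|` (t `&` val b))%fset.
  by rewrite -fsetIUr; apply/esym/fsetIidPl.
have [ta0|ta0] := eqVneq (t `&` val a)%fset fset0.
  left; right; apply: simplex_sub (set_mem (valP b)) _ t0.
  by rewrite tE ta0 fset0U fsubsetIr.
have [tb0|tb0] := eqVneq (t `&` val b)%fset fset0.
  left; left; apply: simplex_sub (set_mem (valP a)) _ t0.
  by rewrite tE tb0 fsetU0 fsubsetIr.
have Ka := simplex_sub (set_mem (valP a)) (fsubsetIr _ _) ta0.
have Mb := simplex_sub (set_mem (valP b)) (fsubsetIr _ _) tb0.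
right; exists (SigSub (mem_set Ka), SigSub (mem_set Mb)) => //=.
by apply: related_down Sab _ _; exact: fsubsetIr.
Qed.

Definition relational_join : simplicial_complex T :=
  SimplicialComplex join_neq0 join_sub.

End Join.

(* The union of the subsets [C] of [E], with the weak topology: a set is open
   iff its trace on each cell [C] is open in [C] for the topology induced by
   [E]. *)
Definition weak_union (E : Type) (cells : set (set E)) : Type :=
  set_type (\bigcup_(C in cells) C).

Section WeakUnion.
Variables (E : topologicalType) (cells : set (set E)).
Local Notation X := (weak_union cells).

Definition weak_union_open : set (set X) :=
  [set U | forall C, cells C -> exists2 B : set E, open B &
           forall x : X, C (val x) -> (U x <-> B (val x))].

Let weak_union_openT : weak_union_open [set: X].
Proof. by move=> C _; exists setT; [exact: openT|]. Qed.

Let weak_union_openI : setI_closed weak_union_open.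
Proof.
move=> U V oU oV C CC; have [B oB UB] := oU C CC; have [D oD VD] := oV C CC.
exists (B `&` D) => [|x Cx]; first exact: openI.
by have := UB x Cx; have := VD x Cx; rewrite /setI /=; tauto.
Qed.

Let weak_union_open_bigU (I : Type) (f : I -> set X) :
  (forall i, weak_union_open (f i)) -> weak_union_open (\bigcup_i f i).
Proof.
move=> fop C CC; have /choice[B hB] i : exists B : set E,
    open B /\ forall x : X, C (val x) -> (f i x <-> B (val x)).
  by have [B oB fB] := fop i C CC; exists B.
exists (\bigcup_i B i) => [|x Cx].
  by apply: bigcup_open => i _; exact: (hB i).1.
by split=> -[i _ fx]; exists i => //; apply/((hB i).2 x Cx).
Qed.

HB.instance Definition _ := Choice.on X.
HB.instance Definition _ := isOpenTopological.Build X
  weak_union_openT weak_union_openI weak_union_open_bigU.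

End WeakUnion.

Section Realization.
Variables (R : realType) (T : choiceType).

(* [||s||] in barycentric coordinates. The topology of pointwise convergence
   on [T -> R] induces on it the Euclidean topology, [s] being finite. *)
Definition closed_simplex (s : {fset T}) : set {ptws T -> R} :=
  [set x | [/\ forall v, 0 <= x v,
               forall v, v \notin s -> x v = 0 &
               \sum_(v <- s) x v = 1]].

Definition realization (K : simplicial_complex T) : topologicalType :=
  weak_union [set closed_simplex s | s in K].

(* The weak topology on [||K|| * ||M||] with respect to the cells
   [||s|| * ||t||] restricts to this one, as this is a subcomplex. *)
Definition relational_product (K M : simplicial_complex T)
    (S : poset_relation (face_poset K) (face_poset M)) : topologicalType :=
  weak_union [set closed_simplex (val p.1) `*` closed_simplex (val p.2)
             | p in S].

End Realization.

Definition std_simplex (R : realType) (n : nat) : set 'rV[R]_n.+1 :=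
  [set t | (forall i, 0 <= t 0 i) /\ \sum_i t 0 i = 1].
Arguments std_simplex : clear implicits.

Section Coface.
Variable R : realType.

(* Inserts a zero at position [i]. *)
Definition coface_row n (i : 'I_n.+2) (t : 'rV[R]_n.+1) : 'rV[R]_n.+2 :=
  \row_j (if unlift i j is Some k then t 0 k else 0).

Lemma coface_row_subproof n (i : 'I_n.+2) (t : std_simplex R n) :
  coface_row i (val t) \in std_simplex R n.+1.
Proof.
have [t0 t1] := set_mem (valP t); rewrite inE; split=> [j|].
  by rewrite mxE; case: unlift.
rewrite (bigD1 i) //= mxE unlift_none add0r -t1.
rewrite (reindex_onto (lift i) (fun j => odflt ord0 (unlift i j))) /=; last first.
  by move=> j; rewrite eq_sym => ij; have [k -> _] := unlift_some ij; rewrite liftK.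
apply: eq_big => [k|k _]; last by rewrite mxE liftK.
by rewrite liftK /= eqxx andbT eq_sym neq_lift.
Qed.

Definition coface n (i : 'I_n.+2) (t : std_simplex R n) : std_simplex R n.+1 :=
  SigSub (coface_row_subproof i t).

Lemma continuous_coface n (i : 'I_n.+2) : continuous (@coface n i).
Proof.
apply: continuous_comp_initial => t A [P Pt sPA].
pose Q k := \bigcap_(j in [set j | unlift i j = Some k]) P 0 j.
have valt : val @ t --> val t by exact: initial_continuous.
apply: (filterS (P := val @^-1` [set u : 'rV[R]_n.+1 | forall k, Q k (u 0 k)])).
  move=> u Qu; apply: sPA => a j; rewrite ord1.
  have := Pt 0 j; rewrite /= !mxE; case: unliftP => [k|] ij; last first.
    by move/nbhs_singleton.
  by move=> _; apply: (Qu k) => /=; rewrite ij liftK.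
apply: valt; exists (fun _ => Q) => [a k|u Qu k]; last exact: Qu.
rewrite ord1.
suff -> : Q k = P 0 (lift i k).
  by have := Pt 0 (lift i k); rewrite mxE liftK.
rewrite predeqE => r; split=> [|Pr j /= jk]; first by apply; rewrite /= liftK.
by case: unliftP jk => // k' -> [->].
Qed.

HB.instance Definition _ n (i : 'I_n.+2) :=
  isContinuous.Build _ _ (@coface n i) (@continuous_coface n i).

End Coface.

Section Homology.
Variables (R : realType) (G : zmodType) (X : topologicalType).

Definition singular n : choiceType := continuousType (std_simplex R n) X.

Definition sing_face n (i : 'I_n.+2) (s : singular n.+1) : singular n :=
  s \o @coface R n i.

(* Finite formal sums of singular simplices with coefficients in [G]; the
   chain [mkmalgU s g] is [g] times the simplex [s]. *)
Definition chain n : zmodType := malg (singular n) G.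

Definition boundary n (c : chain n.+1) : chain n :=
  \sum_(s <- msupp c) \sum_(i < n.+2)
    mkmalgU (sing_face i s) (mcoeff s c) *~ (-1) ^+ i.

Lemma boundaryEw n (D : {fset singular n.+1}) (c : chain n.+1) :
  (msupp c `<=` D)%fset ->
  boundary c = \sum_(s <- D) \sum_(i < n.+2)
    mkmalgU (sing_face i s) (mcoeff s c) *~ (-1) ^+ i.
Proof.
move=> cD; rewrite /boundary (big_fset_incl _ cD) // => s _ sc.
by rewrite big1 // => i _; rewrite mcoeff_outdom // raddf0 mul0rz.
Qed.

Lemma boundary_zmod_morphism n : zmod_morphism (@boundary n).
Proof.
move=> c d; set D := (msupp c `|` msupp d)%fset.
rewrite (@boundaryEw _ D (c - d)) ?msuppB_le //.
rewrite (@boundaryEw _ D c) ?fsubsetUl // (@boundaryEw _ D d) ?fsubsetUr //.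
rewrite -sumrB; apply: eq_bigr => s _; rewrite -sumrB; apply: eq_bigr => i _.
by rewrite raddfB /= raddfB /= mulrzBl.
Qed.

HB.instance Definition _ n := GRing.isZmodMorphism.Build (chain n.+1) (chain n)
  (@boundary n) (@boundary_zmod_morphism n).

(* The boundary of a 0-chain is zero. *)
Definition is_cycle n : pred (chain n) :=
  if n is m.+1 then fun c => boundary c == 0 else xpredT.

Lemma is_cycle_zmod_closed n : zmod_closed (@is_cycle n).
Proof.
case: n => [|n]; first by [].
split=> [|c d]; rewrite !unfold_in /=; first by rewrite raddf0.
by move=> /eqP c0 /eqP d0; rewrite raddfB /= c0 d0 subrr.
Qed.

HB.instance Definition _ n :=
  GRing.isZmodClosed.Build (chain n) (@is_cycle n) (@is_cycle_zmod_closed n).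

Definition sing_cycle n : Type := {c : chain n | is_cycle c}.

HB.instance Definition _ n := SubChoice.on (sing_cycle n).
HB.instance Definition _ n := [SubChoice_isSubZmodule of sing_cycle n by <:].

Definition is_boundary n : pred (sing_cycle n) :=
  fun z => `[< exists c : chain n.+1, boundary c = val z >].

Lemma is_boundary_zmod_closed n : zmod_closed (@is_boundary n).
Proof.
split=> [|y z]; first by apply/asboolP; exists 0; rewrite !raddf0.
move=> /asboolP[c cy] /asboolP[d dz]; apply/asboolP; exists (c - d).
by rewrite !raddfB /= cy dz.
Qed.

HB.instance Definition _ n := GRing.isZmodClosed.Build (sing_cycle n)
  (@is_boundary n) (@is_boundary_zmod_closed n).

Definition homology n : zmodType :=
  Quotient.quot (GRing.ZmodClosed.clone (sing_cycle n) (@is_boundary n) _).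

End Homology.

Definition exact_at (A B C : zmodType) (f : A -> B) (g : B -> C) : Prop :=
  range f = g @^-1` [set 0].

(* Main.v *)
(** Write [J] for the realization of the join, [A] and [B] for the vertex sets
    of [K] and [M], and [mass A x] for the total barycentric weight of [x] on
    [A]. The sets [mass A > 0] and [mass B > 0] are open and cover [J].
    Restricting a point to [A] (resp. [B]) and normalizing retracts them onto
    [||K||] and [||M||]; doing both retracts their intersection onto the
    relational product, embedded in [J] as the set of midpoints of join lines.
    All three retractions are homotopic to the identity along straight lines,
    so the Mayer-Vietoris sequence of the cover is the required one.

    The small-simplices theorem and homotopy invariance both come from one
    construction on affine chains: a natural chain homotopy [D] between two
    natural chain maps, defined by [D w = b(w) (alpha w - beta w - D (d w))]
    with [b(w)] the cone from the barycenter of [w]. *)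
Require Import Defs.
From mathcomp Require Import all_boot all_order all_algebra finmap.
From mathcomp Require Import all_classical all_reals all_analysis.
From mathcomp Require monalg.
Import -(notations) monalg.
From HB Require Import structures.

Set Implicit Arguments.
Unset Strict Implicit.
Unset Printing Implicit Defensive.

Import Order.TTheory GRing.Theory Num.Theory.
Import numFieldNormedType.Exports.

Local Open Scope classical_set_scope.
Local Open Scope ring_scope.

(** * Chains with prescribed support *)

(** The obstacle is topological: realizations carry the weak topology, for which continuity on a
    product with an interval is delicate, and the retractions are defined on open subsets only.
    Singular chains see a space only through continuous maps out of simplices. So a retraction is a
    relation that must lift singular simplices, and a homotopy one that must lift pairs of a
    singular simplex and a time function on it. The open sets never become spaces either: chains of
    the join supported in an open set stand for its chains, and the only homology groups formed are
    those of the statement. The parameter one half gives a midpoint mass [2^-1] on each side, and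
    normalizing a midpoint returns its two ends. Hence retracting after embedding is the identity on
    the nose, and on the overlap the retractions onto the realizations of [K] and [M] factor
    strictly through the product. Disjointness of the vertex sets makes the decomposition of a
    simplex of the join canonical: its trace on each vertex set is empty or a simplex of that
    complex, and two nonempty traces form a related pair. *)

Section Malg.
Variable G : zmodType.

Definition supp_in (A : choiceType) (Q : set A) : set (malg A G) :=
  [set c | forall a, a \in msupp c -> Q a].

Section Lift.
Variables (A : choiceType) (V : zmodType) (F : A -> {additive G -> V}).

(** The additive extension from generators. Since [G] is a bare abelian group, a generator is sent
    to an additive map on coefficients and not to an element of [V]. *)
Definition malg_lift (c : malg A G) : V :=
  \sum_(a <- msupp c) F a (mcoeff a c).

Lemma malg_liftEw (D : {fset A}) (c : malg A G) : (msupp c `<=` D)%fset ->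
  malg_lift c = \sum_(a <- D) F a (mcoeff a c).
Proof.
move=> cD; rewrite /malg_lift (big_fset_incl _ cD) // => a _ ac.
by rewrite mcoeff_outdom // raddf0.
Qed.

Lemma malg_lift_zmod_morphism : zmod_morphism malg_lift.
Proof.
move=> c d; set D := (msupp c `|` msupp d)%fset.
rewrite (@malg_liftEw D (c - d)) ?msuppB_le //.
rewrite (@malg_liftEw D c) ?fsubsetUl // (@malg_liftEw D d) ?fsubsetUr //.
by rewrite -sumrB; apply: eq_bigr => a _; rewrite !raddfB.
Qed.

HB.instance Definition _ := GRing.isZmodMorphism.Build (malg A G) V
  malg_lift malg_lift_zmod_morphism.

Lemma malg_liftU a g : malg_lift (mkmalgU a g) = F a g.
Proof.
rewrite (malg_liftEw msuppU_le) big_seq_fset1 mcoeffU eqxx //.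
Qed.

End Lift.

Lemma supp_in0 (A : choiceType) (Q : set A) : supp_in Q 0.
Proof. by move=> a; rewrite msupp0. Qed.

Lemma supp_inD (A : choiceType) (Q : set A) c d :
  supp_in Q c -> supp_in Q d -> supp_in Q (c + d).
Proof.
move=> Qc Qd a /(fsubsetP (msuppD_le _ _)).
by rewrite in_fsetU => /orP[/Qc|/Qd].
Qed.

Lemma supp_inN (A : choiceType) (Q : set A) c : supp_in Q c -> supp_in Q (- c).
Proof. by move=> Qc a; rewrite msuppN => /Qc. Qed.

Lemma supp_inB (A : choiceType) (Q : set A) c d :
  supp_in Q c -> supp_in Q d -> supp_in Q (c - d).
Proof. by move=> Qc Qd; apply: supp_inD => //; exact: supp_inN. Qed.

Lemma supp_inU (A : choiceType) (Q : set A) a g :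
  Q a -> supp_in Q (mkmalgU a g).
Proof. by move=> Qa b /(fsubsetP msuppU_le); rewrite in_fset1 => /eqP ->. Qed.

Arguments supp_inU {A Q a} g _.

Lemma supp_in_sum (A : choiceType) (Q : set A) (I : Type) (r : seq I) (P : pred I)
    (F : I -> malg A G) :
  (forall i, P i -> supp_in Q (F i)) -> supp_in Q (\sum_(i <- r | P i) F i).
Proof.
move=> QF; apply: (big_ind (fun c => supp_in Q c)) => //.
- exact: supp_in0.
- by move=> c d; exact: supp_inD.
Qed.

Lemma supp_in_sign (A : choiceType) (Q : set A) c i :
  supp_in Q c -> supp_in Q (c *~ (-1) ^+ i).
Proof.
move=> Qc; rewrite -signr_odd; case: odd; last by rewrite expr0.
by rewrite expr1 mulrNz; exact: supp_inN.
Qed.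

Lemma supp_in_sub (A : choiceType) (Q Q' : set A) c :
  Q `<=` Q' -> supp_in Q c -> supp_in Q' c.
Proof. by move=> QQ' Qc a /Qc /QQ'. Qed.

Lemma supp_inT (A : choiceType) (c : malg A G) : supp_in setT c.
Proof. by []. Qed.

Lemma supp_ind (A : choiceType) (Q : set A) (P : malg A G -> Prop) :
  P 0 -> (forall c d, P c -> P d -> P (c + d)) ->
  (forall a g, Q a -> P (mkmalgU a g)) -> forall c, supp_in Q c -> P c.
Proof.
move=> P0 PD PU c Qc; rewrite (monalgEw (fsubset_refl (msupp c))) big_seq.
apply: (big_ind P) => // a ac; apply: PU; exact: Qc.
Qed.

(** Reduces chain identities to one generator. The restriction to [Q] matters because lifts along
    partial maps behave well only on simplices that do lift. *)
Lemma additive_eq_on (A : choiceType) (V : zmodType) (Q : set A)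
    (f h : {additive malg A G -> V}) :
  (forall a g, Q a -> f (mkmalgU a g) = h (mkmalgU a g)) ->
  forall c, supp_in Q c -> f c = h c.
Proof.
move=> fh; apply: supp_ind => [|c d fc fd|//]; first by rewrite !raddf0.
by rewrite !raddfD fc fd.
Qed.

Lemma additive_eq (A : choiceType) (V : zmodType)
    (f h : {additive malg A G -> V}) :
  (forall a g, f (mkmalgU a g) = h (mkmalgU a g)) -> f =1 h.
Proof. by move=> fh c; apply: additive_eq_on (@supp_inT _ c) => a g _. Qed.

Lemma additive_supp_in (A B : choiceType) (Q : set A) (Q' : set B)
    (f : {additive malg A G -> malg B G}) :
  (forall a g, Q a -> supp_in Q' (f (mkmalgU a g))) ->
  forall c, supp_in Q c -> supp_in Q' (f c).
Proof.
move=> fQ; apply: supp_ind => [|c d fc fd|//]; first by rewrite raddf0; exact: supp_in0.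
by rewrite raddfD; exact: supp_inD.
Qed.

Lemma supp_inUl (A : choiceType) (Q1 Q2 : set A) c :
  supp_in (Q1 `|` Q2) c ->
  exists u v, [/\ c = u + v, supp_in Q1 u & supp_in Q2 v].
Proof.
move: c; apply: supp_ind.
- by exists 0, 0; rewrite addr0; split=> //; exact: supp_in0.
- move=> c d [u [v [-> Qu Qv]]] [u' [v' [-> Qu' Qv']]].
  by exists (u + u'), (v + v'); rewrite addrACA; split=> //; exact: supp_inD.
- move=> a g [Qa|Qa]; [exists (mkmalgU a g), 0|exists 0, (mkmalgU a g)];
  by rewrite ?addr0 ?add0r; split=> //; (exact: supp_in0 || exact: supp_inU).
Qed.

Lemma supp_inI (A : choiceType) (Q1 Q2 : set A) c :
  supp_in Q1 c -> supp_in Q2 c -> supp_in (Q1 `&` Q2) c.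
Proof. by move=> Q1c Q2c a ac; split; [exact: Q1c|exact: Q2c]. Qed.

End Malg.

Arguments supp_inU {G A Q a} g _.

(** * Affine chains *)

(* Affine simplices are given by the list of their vertices. The empty list is
   allowed, so the complex is augmented and [word_boundary_cone] needs no
   special case in degree zero. *)
Section Words.
Variable G : zmodType.

Local Notation word_chain V := (malg (seq V) G).

Section Boundary.
Variable V : choiceType.
Implicit Types (w : seq V) (c : word_chain V).

Definition word_face i w := take i w ++ drop i.+1 w.

Definition cone x : word_chain V -> word_chain V :=
  malg_lift (fun w => mkmalgU (x :: w)).
HB.instance Definition _ x := GRing.Additive.on (cone x).

Definition word_boundary_gen w (g : G) : word_chain V :=
  \sum_(i < size w) mkmalgU (word_face i w) g *~ (-1) ^+ i.

Lemma word_boundary_gen_zmod_morphism w : zmod_morphism (word_boundary_gen w).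
Proof.
move=> g h; rewrite -sumrB; apply: eq_bigr => i _.
by rewrite raddfB /= mulrzBl.
Qed.

HB.instance Definition _ w := GRing.isZmodMorphism.Build G (word_chain V)
  (word_boundary_gen w) (@word_boundary_gen_zmod_morphism w).

Definition word_boundary : word_chain V -> word_chain V :=
  malg_lift word_boundary_gen.
HB.instance Definition _ := GRing.Additive.on word_boundary.

Lemma coneU x w g : cone x (mkmalgU w g) = mkmalgU (x :: w) g.
Proof. by rewrite /cone malg_liftU. Qed.

Lemma word_boundaryU w g : word_boundary (mkmalgU w g) =
  \sum_(i < size w) mkmalgU (word_face i w) g *~ (-1) ^+ i.
Proof. by rewrite /word_boundary malg_liftU. Qed.

(** Deleting the apex gives back [c]; every other face is a cone whose index is shifted by one,
    whence the minus sign. *)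
Lemma word_boundary_cone x c :
  word_boundary (cone x c) = c - cone x (word_boundary c).
Proof.
pose f : {additive word_chain V -> word_chain V} := word_boundary \o cone x.
pose h : {additive word_chain V -> word_chain V} :=
  idfun \- (cone x \o word_boundary).
apply: (additive_eq (f := f) (h := h)) => w g /=.
rewrite coneU !word_boundaryU /= big_ord_recl /= /word_face /= drop0; congr (_ + _).
rewrite [cone x _](raddf_sum (cone x)) -sumrN; apply: eq_bigr => i _ /=.
by rewrite (raddfMz (cone x)) /= coneU exprS mulN1r mulrNz.
Qed.

(** A nonempty word is the cone over its tail, so the cone formula and induction replace the usual
    cancellation in a double sum. *)
Lemma word_boundaryK c : word_boundary (word_boundary c) = 0.
Proof.
pose f : {additive word_chain V -> word_chain V} := word_boundary \o word_boundary.
apply: (additive_eq (f := f) (h := \0)) => w g; rewrite {}/f /=.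
elim: w => [|x w IHw]; first by rewrite word_boundaryU big_ord0 raddf0.
by rewrite -coneU word_boundary_cone raddfB /= word_boundary_cone IHw raddf0 subr0 subrr.
Qed.

End Boundary.

End Words.

(** * Subdivision and cone homotopies of affine chains *)

Section WordOperators.
Variable G : zmodType.
Local Notation word_chain V := (malg (seq V) G).

Definition map_words (V V' : choiceType) (f : V -> V') :
    word_chain V -> word_chain V' :=
  malg_lift (fun w => mkmalgU (map f w)).
HB.instance Definition _ (V V' : choiceType) (f : V -> V') :=
  GRing.Additive.on (map_words f).

Lemma map_wordsU (V V' : choiceType) (f : V -> V') w g :
  map_words f (mkmalgU w g) = mkmalgU (map f w) g.
Proof. by rewrite /map_words malg_liftU. Qed.

Lemma map_words_cone (V V' : choiceType) (f : V -> V') x c :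
  map_words f (cone x c) = cone (f x) (map_words f c).
Proof.
pose l : {additive word_chain V -> word_chain V'} := map_words f \o cone x.
pose r : {additive word_chain V -> word_chain V'} := cone (f x) \o map_words f.
by apply: (additive_eq (f := l) (h := r)) => w g /=; rewrite coneU !map_wordsU coneU.
Qed.

Lemma map_word_face (V V' : choiceType) (f : V -> V') i w :
  map f (word_face i w) = word_face i (map f w).
Proof. by rewrite /word_face map_cat map_take map_drop. Qed.

Lemma map_words_boundary (V V' : choiceType) (f : V -> V') c :
  map_words f (word_boundary c) = word_boundary (map_words f c).
Proof.
pose l : {additive word_chain V -> word_chain V'} := map_words f \o @word_boundary G V.
pose r : {additive word_chain V -> word_chain V'} := @word_boundary G V' \o map_words f.
apply: (additive_eq (f := l) (h := r)) => w g /=.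
rewrite map_wordsU !word_boundaryU raddf_sum size_map; apply: eq_bigr => i _.
by rewrite (raddfMz (map_words f)) /= map_wordsU map_word_face.
Qed.

Lemma map_words_comp (V V' V'' : choiceType) (f : V -> V') (h : V' -> V'') c :
  map_words h (map_words f c) = map_words (h \o f) c.
Proof.
pose l : {additive word_chain V -> word_chain V''} := map_words h \o map_words f.
by apply: (additive_eq (f := l)) => w g /=; rewrite !map_wordsU map_comp.
Qed.

Section Subdivision.
Variables (V : choiceType) (b : seq V -> V).

(* [n] is the number of vertices of the simplices to be subdivided. The chain
   map identity below holds on all words, but the operator is meaningful on
   words of size [n] only. *)
Fixpoint subdivision_rec n : {additive word_chain V -> word_chain V} :=
  if n is m.+1 then
    malg_lift (fun w => cone (b w) \o
      (subdivision_rec m \o (@word_boundary G V \o mkmalgU w)))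
  else idfun.

Definition subdivision n : word_chain V -> word_chain V := subdivision_rec n.
HB.instance Definition _ n := GRing.Additive.on (subdivision n).
Arguments subdivision : simpl never.

Lemma subdivisionU n w g : subdivision n.+1 (mkmalgU w g) =
  cone (b w) (subdivision n (word_boundary (mkmalgU w g))).
Proof. by rewrite /subdivision /= malg_liftU. Qed.

(** The error term of the cone formula is the cone over the boundary of the subdivided boundary,
    which vanishes by induction whatever the apex function [b] is. *)
Lemma subdivision_boundary n c :
  word_boundary (subdivision n.+1 c) = subdivision n (word_boundary c).
Proof.
elim: n c => [|n IHn] c.
  pose l : {additive word_chain V -> word_chain V} := @word_boundary G V \o subdivision 1.
  apply: (additive_eq (f := l)) => w g; rewrite /l [LHS]/=.
  by rewrite subdivisionU word_boundary_cone /subdivision /= word_boundaryK raddf0 subr0.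
pose l : {additive word_chain V -> word_chain V} := @word_boundary G V \o subdivision n.+2.
pose r : {additive word_chain V -> word_chain V} := subdivision n.+1 \o @word_boundary G V.
apply: (additive_eq (f := l) (h := r)) => w g; rewrite /l /r [LHS]/=.
rewrite subdivisionU word_boundary_cone IHn word_boundaryK.
by rewrite (raddf0 (subdivision n)) raddf0 subr0.
Qed.

End Subdivision.

Arguments subdivision : simpl never.

(** Linear maps commute with barycenters, so this naturality applies to cofaces and to affine
    parametrizations; it is what carries subdivision over to singular chains. *)
Lemma map_subdivision (V V' : choiceType) (b : seq V -> V) (b' : seq V' -> V')
    (f : V -> V') : (forall w, f (b w) = b' (map f w)) ->
  forall n c, map_words f (subdivision b n c) = subdivision b' n (map_words f c).
Proof.
move=> fb; elim=> [//|n IHn] c.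
pose l : {additive word_chain V -> word_chain V'} := map_words f \o subdivision b n.+1.
pose r : {additive word_chain V -> word_chain V'} := subdivision b' n.+1 \o map_words f.
apply: (additive_eq (f := l) (h := r)) => w g; rewrite /l /r [LHS]/= [RHS]/=.
by rewrite subdivisionU map_words_cone IHn map_words_boundary map_wordsU subdivisionU fb.
Qed.

(** Here [n] counts vertices, so a simplex of dimension [n] is a word in [words n.+1], and [words 0]
    contains the empty word only. *)
Definition words (V : choiceType) n (P : set V) : set (seq V) :=
  [set w | size w = n /\ forall x, x \in w -> P x].

Lemma word_face_words (V : choiceType) n (P : set V) w i :
  words n.+1 P w -> (i < size w)%N -> words n P (word_face i w).
Proof.
move=> [wn wP] iw; split=> [|x].
  by rewrite size_cat size_take size_drop iw wn subSS subnKC // -ltnS -wn.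
by rewrite mem_cat => /orP[/mem_take|/mem_drop]; exact: wP.
Qed.

Lemma word_boundary_supp (V : choiceType) (Q Q' : set (seq V)) (c : word_chain V) :
  (forall w i, Q w -> (i < size w)%N -> Q' (word_face i w)) ->
  supp_in Q c -> supp_in Q' (word_boundary c).
Proof.
move=> QQ'; apply: additive_supp_in => w g Qw.
rewrite /= word_boundaryU; apply: supp_in_sum => i _.
by apply: supp_in_sign; apply: supp_inU; apply: QQ'.
Qed.

Lemma word_boundary_words (V : choiceType) n (P : set V) (c : word_chain V) :
  supp_in (words n.+1 P) c -> supp_in (words n P) (word_boundary c).
Proof. by apply: word_boundary_supp => w i; exact: word_face_words. Qed.

Lemma cone_words (V : choiceType) n (P : set V) x (c : word_chain V) : P x ->
  supp_in (words n P) c -> supp_in (words n.+1 P) (cone x c).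
Proof.
move=> Px; apply: additive_supp_in => w g [wn wP]; rewrite /= coneU.
apply: supp_inU; split=> [|y]; first by rewrite /= wn.
by rewrite inE => /orP[/eqP ->|/wP].
Qed.

Lemma map_words_supp (V V' : choiceType) (f : V -> V') n (P : set V)
    (P' : set V') (c : word_chain V) :
  (forall x, P x -> P' (f x)) ->
  supp_in (words n P) c -> supp_in (words n P') (map_words f c).
Proof.
move=> fP; apply: additive_supp_in => w g [wn wP]; rewrite /= map_wordsU.
by apply: supp_inU; split=> [|_ /mapP[x /wP /fP ? ->]//]; rewrite size_map.
Qed.

Lemma subdivision_words (V : choiceType) (b : seq V -> V) (P : set V) :
  (forall n w, words n.+1 P w -> P (b w)) -> forall n (c : word_chain V),
  supp_in (words n P) c -> supp_in (words n P) (subdivision b n c).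
Proof.
move=> bP; elim=> [//|n IHn]; apply: additive_supp_in => w g wP.
rewrite /= subdivisionU; apply: cone_words; first exact: bP wP.
apply: IHn; apply: word_boundary_words; exact: supp_inU.
Qed.

Section ConeHomotopy.
Variables (V V' : choiceType) (b : seq V -> V').
Variables alpha beta : nat -> {additive word_chain V -> word_chain V'}.

Fixpoint cone_homotopy_rec n : {additive word_chain V -> word_chain V'} :=
  if n is m.+1 then
    malg_lift (fun w => cone (b w) \o
      (((alpha m.+1 \- beta m.+1) \- (cone_homotopy_rec m \o @word_boundary G V))
       \o mkmalgU w))
  else \0.

Definition cone_homotopy n : word_chain V -> word_chain V' := cone_homotopy_rec n.
HB.instance Definition _ n := GRing.Additive.on (cone_homotopy n).
Arguments cone_homotopy : simpl never.

Lemma cone_homotopyU n w (g : G) : let c := mkmalgU w g in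
  cone_homotopy n.+1 c =
  cone (b w) (alpha n.+1 c - beta n.+1 c - cone_homotopy n (word_boundary c)).
Proof. by rewrite /cone_homotopy /= malg_liftU. Qed.

Lemma cone_homotopy0 c : cone_homotopy 0 c = 0.
Proof. by []. Qed.

Hypothesis alpha_boundary : forall n c,
  word_boundary (alpha n.+1 c) = alpha n (word_boundary c).
Hypothesis beta_boundary : forall n c,
  word_boundary (beta n.+1 c) = beta n (word_boundary c).
Hypothesis alpha_beta0 : forall g, alpha 0 (mkmalgU [::] g) = beta 0 (mkmalgU [::] g).

(** The chain under the cone is a cycle by induction, so the boundary of the cone is that chain. In
    the base case the boundary of a one-letter word is a multiple of the empty word, where [alpha]
    and [beta] agree: this is the augmentation condition. *)
Lemma cone_homotopy_boundary n c : supp_in (words n.+1 setT) c ->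
  word_boundary (cone_homotopy n.+1 c) =
  alpha n.+1 c - beta n.+1 c - cone_homotopy n (word_boundary c).
Proof.
elim: n c => [|n IHn].
  pose l : {additive word_chain V -> word_chain V'} :=
    @word_boundary G V' \o cone_homotopy 1.
  pose r : {additive word_chain V -> word_chain V'} :=
    (alpha 1 \- beta 1) \- (cone_homotopy 0 \o @word_boundary G V).
  apply: (additive_eq_on (f := l) (h := r)) => w g wP; rewrite /l /r [LHS]/= [RHS]/=.
  rewrite cone_homotopyU word_boundary_cone !cone_homotopy0 !subr0 raddfB /=.
  rewrite alpha_boundary beta_boundary.
  suff -> : alpha 0 (word_boundary (mkmalgU w g)) = beta 0 (word_boundary (mkmalgU w g)).
    by rewrite subrr raddf0 subr0.
  apply: (additive_eq_on (Q := words 0 setT)); last first.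
    by apply: word_boundary_words; exact: supp_inU.
  by move=> v h [/size0nil -> _]; exact: alpha_beta0.
pose l : {additive word_chain V -> word_chain V'} :=
  @word_boundary G V' \o cone_homotopy n.+2.
pose r : {additive word_chain V -> word_chain V'} :=
  (alpha n.+2 \- beta n.+2) \- (cone_homotopy n.+1 \o @word_boundary G V).
apply: (additive_eq_on (f := l) (h := r)) => w g wP; rewrite /l /r [LHS]/= [RHS]/=.
rewrite cone_homotopyU word_boundary_cone.
set d := _ - _ - _; suff -> : word_boundary d = 0 by rewrite raddf0 subr0.
rewrite !raddfB /= alpha_boundary beta_boundary IHn.
  by rewrite word_boundaryK (raddf0 (cone_homotopy n)) subr0 subrr.
by apply: word_boundary_words; exact: supp_inU.
Qed.

Lemma cone_homotopy_words (P : set V) (P' : set V') :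
  (forall n w, words n.+1 P w -> P' (b w)) ->
  (forall n (c : word_chain V), supp_in (words n P) c -> supp_in (words n P') (alpha n c)) ->
  (forall n (c : word_chain V), supp_in (words n P) c -> supp_in (words n P') (beta n c)) ->
  forall n c, supp_in (words n P) c -> supp_in (words n.+1 P') (cone_homotopy n c).
Proof.
move=> bP alphaP betaP; elim=> [c _|n IHn]; first exact: supp_in0.
apply: additive_supp_in => w g wP; have wP' := supp_inU g wP.
rewrite /= cone_homotopyU; apply: cone_words; first exact: bP wP.
apply: supp_inB; first by apply: supp_inB; [exact: alphaP|exact: betaP].
by apply: IHn; exact: word_boundary_words.
Qed.

End ConeHomotopy.

Arguments cone_homotopy : simpl never.

Lemma map_cone_homotopy (V V' W W' : choiceType) (b : seq V -> V') (d : seq W -> W')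
    (alpha beta : nat -> {additive word_chain V -> word_chain V'})
    (gamma delta : nat -> {additive word_chain W -> word_chain W'})
    (f : V -> W) (f' : V' -> W') :
  (forall w, f' (b w) = d (map f w)) ->
  (forall n c, map_words f' (alpha n c) = gamma n (map_words f c)) ->
  (forall n c, map_words f' (beta n c) = delta n (map_words f c)) ->
  forall n c, map_words f' (cone_homotopy b alpha beta n c) =
              cone_homotopy d gamma delta n (map_words f c).
Proof.
move=> fb fal fbe; elim=> [|n IHn] c; first by rewrite /cone_homotopy /= raddf0.
pose l : {additive word_chain V -> word_chain W'} :=
  map_words f' \o cone_homotopy b alpha beta n.+1.
pose r : {additive word_chain V -> word_chain W'} :=
  cone_homotopy d gamma delta n.+1 \o map_words f.
apply: (additive_eq (f := l) (h := r)) => w g; rewrite /l /r [LHS]/= [RHS]/=.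
rewrite cone_homotopyU map_words_cone !raddfB /= fal fbe IHn map_words_boundary.
by rewrite map_wordsU cone_homotopyU fb !raddfB.
Qed.

End WordOperators.

(** * Barycenters and the mesh of a subdivision *)

Section Barycenter.
Variables (R : numFieldType) (G : zmodType).

Definition barycenter (V : lmodType R) (w : seq V) : V :=
  (size w)%:R^-1 *: \sum_(x <- w) x.

Lemma map_barycenter (V V' : lmodType R) (f : {linear V -> V'}) w :
  f (barycenter w) = barycenter (map f w).
Proof. by rewrite /barycenter linearZ /= linear_sum size_map big_map. Qed.

Definition mesh_le (V : normedModType R) n (e : R) : set (seq V) :=
  [set w | size w = n /\ {in w &, forall x y, `|x - y| <= e}].

Lemma barycenter_ball (V : normedModType R) (x : V) (e : R) w :
  w != [::] -> (forall y, y \in w -> `|x - y| <= e) -> `|x - barycenter w| <= e.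
Proof.
move=> w0 we; have wgt0 : 0 < (size w)%:R :> R by rewrite ltr0n lt0n size_eq0.
have -> : x - barycenter w = (size w)%:R^-1 *: \sum_(y <- w) (x - y).
  rewrite sumrB scalerBr big_const_seq count_predT iter_addr_0 -[x *+ _]scaler_nat.
  by rewrite scalerA mulVf ?scale1r // gt_eqF.
rewrite normrZ gtr0_norm ?invr_gt0 // mulrC ler_pdivrMr //.
apply: (le_trans (ler_norm_sum _ _ _)); rewrite big_seq.
apply: (@le_trans _ _ (\sum_(y <- w | y \in w) e)); first exact: ler_sum.
by rewrite -big_seq big_const_seq count_predT iter_addr_0 mulr_natr.
Qed.

(** The difference is the average of the [n.+1] vectors from [x] to the vertices, one of which is
    zero. This is the origin of the ratio [n / n.+1]. *)
Lemma mesh_barycenter (V : normedModType R) n (e : R) (w : seq V) x :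
  mesh_le n.+1 e w -> x \in w -> `|barycenter w - x| <= n%:R / n.+1%:R * e.
Proof.
move=> [wn we] xw; have n0 : 0 < n.+1%:R :> R by rewrite ltr0n.
have -> : barycenter w - x = n.+1%:R^-1 *: \sum_(y <- w) (y - x).
  rewrite sumrB scalerBr big_const_seq count_predT iter_addr_0 -[x *+ _]scaler_nat wn.
  by rewrite scalerA mulVf ?scale1r ?gt_eqF // /barycenter wn.
rewrite normrZ gtr0_norm ?invr_gt0 // mulrAC mulrC ler_wpM2r ?invr_ge0 ?(ltW n0) //.
rewrite (big_rem x) //= subrr add0r.
apply: (le_trans (ler_norm_sum _ _ _)); rewrite big_seq.
apply: (@le_trans _ _ (\sum_(y <- rem x w | y \in rem x w) e)).
  by apply: ler_sum => y /mem_rem yw; exact: we.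
by rewrite -big_seq big_const_seq count_predT iter_addr_0 size_rem // wn mulr_natl.
Qed.

(** A subdivided simplex is the barycenter of [w] followed by a simplex from a subdivided face.
    Distances inside the latter are bounded by induction. Distances to the barycenter are bounded
    because the ball [B] contains the vertices of [w] and, being convex, all later barycenters. The
    fixed bound [N] keeps one ratio for all faces. *)
Lemma subdivision_mesh (V : normedModType R) N n (e : R) (c : malg (seq V) G) :
  0 <= e -> (n <= N.+1)%N ->
  supp_in (mesh_le n e) c ->
  supp_in (mesh_le n (N%:R / N.+1%:R * e)) (subdivision (@barycenter V) n c).
Proof.
move=> e0; elim: n c => [|n IHn] c nN.
  by apply: supp_in_sub => w [/size0nil ->]; split.
move: c; apply: additive_supp_in => w g wm; rewrite /= subdivisionU.
set c := word_boundary _.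
have cm : supp_in (mesh_le n e) c.
  apply: (word_boundary_supp _ (supp_inU g wm)) => v i [vn ve] iv.
  have [? vf] := word_face_words (conj vn (fun _ _ => I) : words n.+1 setT v) iv.
  split=> // x y xv yv; apply: ve; move: xv yv; rewrite !mem_cat.
    by move=> /orP[/mem_take|/mem_drop].
  by move=> _ /orP[/mem_take|/mem_drop].
pose B : set V := [set x | `|barycenter w - x| <= N%:R / N.+1%:R * e].
have cB : supp_in (words n B) c.
  apply: word_boundary_words; apply: supp_inU; split; first exact: wm.1.
  move=> x xw; apply: le_trans (mesh_barycenter wm xw) _.
  rewrite ler_wpM2r // ler_pdivrMr ?ltr0n // mulrAC ler_pdivlMr ?ltr0n //.
  by rewrite -!natrM ler_nat mulnS mulnC mulnS leq_add2r.
have SB : supp_in (words n B) (subdivision (@barycenter V) n c).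
  apply: subdivision_words cB => k v [vk vB].
  by apply: barycenter_ball => //; rewrite -size_eq0 vk.
have Sm := IHn c (ltnW nN) cm.
apply: additive_supp_in (supp_inI Sm SB) => v h [[vn vm] [_ vB]].
rewrite /= coneU; apply: supp_inU; split; first by rewrite /= vn.
have r0 : 0 <= N%:R / N.+1%:R * e by rewrite mulr_ge0 // divr_ge0.
move=> x y; rewrite !inE => /orP[/eqP ->|xv] /orP[/eqP ->|yv].
- by rewrite subrr normr0.
- exact: vB.
- by rewrite distrC; exact: vB.
- exact: vm.
Qed.

End Barycenter.

(** * Singular chains and partial maps *)

Section RelLift.
Variables (G : zmodType) (A B : choiceType) (r : A -> B -> Prop).

(** A generator without partner is sent to zero, so that a partial map induces a total additive map.
    The choice made by [cid] is immaterial once partners are unique. *)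
Definition rel_gen (a : A) : G -> malg B G :=
  match pselect (exists b, r a b) with
  | left h => mkmalgU (sval (cid h))
  | right _ => fun=> 0
  end.

Lemma rel_gen_zmod_morphism a : zmod_morphism (rel_gen a).
Proof.
rewrite /rel_gen => g h; case: pselect => [?|_]; first by rewrite raddfB.
by rewrite subr0.
Qed.

HB.instance Definition _ a :=
  GRing.isZmodMorphism.Build G (malg B G) (rel_gen a) (rel_gen_zmod_morphism a).

Definition rel_lift : malg A G -> malg B G := malg_lift rel_gen.
HB.instance Definition _ := GRing.Additive.on rel_lift.

Lemma rel_liftU a b g : (forall b', r a b' -> b' = b) -> r a b ->
  rel_lift (mkmalgU a g) = mkmalgU b g.
Proof.
move=> rb ab; rewrite /rel_lift malg_liftU /= /rel_gen.
by case: pselect => [h|[]]; [case: cid => b' /= /rb ->|exists b].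
Qed.

Lemma rel_lift_supp (Q : set A) (Q' : set B) c :
  (forall a b, Q a -> r a b -> Q' b) -> supp_in Q c -> supp_in Q' (rel_lift c).
Proof.
move=> QQ'; apply: additive_supp_in => a g Qa; rewrite /= /rel_lift malg_liftU /= /rel_gen.
case: pselect => [h|_]; last exact: supp_in0.
by case: cid => b /= ab; apply: supp_inU; exact: QQ' ab.
Qed.

End RelLift.

Definition functional_rel (A B : Type) (r : A -> B -> Prop) :=
  forall a b b', r a b -> r a b' -> b = b'.

(** * Affine simplices in barycentric coordinates *)

Section Comb.
Variable R : realType.

Definition comb (V : lmodType R) n (w : seq V) (t : 'rV[R]_n.+1) : V :=
  \sum_(i < n.+1) t 0 i *: w`_i.

Lemma comb_is_linear (V : lmodType R) n (w : seq V) : linear (@comb V n w).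
Proof.
move=> a t u; rewrite /comb scaler_sumr -big_split /=; apply: eq_bigr => i _.
by rewrite !mxE scalerDl scalerA.
Qed.

HB.instance Definition _ (V : lmodType R) n (w : seq V) :=
  GRing.isLinear.Build R 'rV[R]_n.+1 V *:%R (@comb V n w) (comb_is_linear w).

Lemma comb_map (V V' : lmodType R) (f : {linear V -> V'}) n (w : seq V) t :
  comb (map f w) t = f (@comb V n w t).
Proof.
rewrite /comb linear_sum; apply: eq_bigr => i _; rewrite linearZ /=.
have [iw|wi] := ltnP i (size w); first by rewrite (nth_map 0).
by rewrite !nth_default ?size_map // (linear0 f).
Qed.

Definition std_basis n : seq 'rV[R]_n.+1 := [seq delta_mx 0 i | i : 'I_n.+1].

Lemma size_std_basis n : size (std_basis n) = n.+1.
Proof. by rewrite size_map size_enum_ord. Qed.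

Lemma nth_std_basis n (i : 'I_n.+1) : (std_basis n)`_i = delta_mx 0 i.
Proof. by rewrite (nth_map i) ?size_enum_ord // nth_ord_enum. Qed.

Lemma comb_std_basis n t : comb (std_basis n) t = t.
Proof.
by rewrite /comb [RHS]row_sum_delta; apply: eq_bigr => i _; rewrite nth_std_basis.
Qed.

Lemma map_comb_std_basis (V : lmodType R) n (w : seq V) : size w = n.+1 ->
  map (comb w) (std_basis n) = w.
Proof.
move=> wn; apply: (@eq_from_nth _ 0); first by rewrite size_map size_std_basis.
move=> i; rewrite size_map size_std_basis => iN.
rewrite (nth_map 0) ?size_std_basis // (nth_std_basis (Ordinal iN)) /comb.
rewrite (bigD1 (Ordinal iN)) //= mxE !eqxx scale1r big1 ?addr0 // => j ji.
by rewrite mxE (negbTE ji) andbF scale0r.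
Qed.

Lemma nth_word_face (V : lmodType R) (w : seq V) i k :
  (word_face i w)`_k = w`_(bump i k).
Proof.
rewrite /word_face nth_cat size_take_min /bump.
have [iw|wi] := leqP i (size w).
  case: (ltnP k i) => ki /=; first by rewrite nth_take.
  by rewrite nth_drop add1n addSn subnKC.
rewrite drop_oversize ?(leq_trans (ltnW wi)) // take_oversize ?(ltnW wi) //.
rewrite nth_nil.
have -> : (if (k < size w)%N then w`_k else 0) = w`_k.
  by case: ltnP => // wk; rewrite nth_default.
case: leqP => //= ik; have wk := leq_trans (ltnW wi) ik.
by rewrite add1n !nth_default // ltnW.
Qed.

(** A zero coordinate at position [i] discards the vertex there. This matches the faces of singular
    simplices with those of words. *)
Lemma comb_word_face (V : lmodType R) n (w : seq V) (i : 'I_n.+2) t :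
  comb w (coface_row i t) = @comb V n (word_face i w) t.
Proof.
rewrite /comb (bigD1 i) //= mxE unlift_none scale0r add0r.
rewrite (reindex_onto (lift i) (fun j => odflt ord0 (unlift i j))) /=; last first.
  by move=> j; rewrite eq_sym => ij; have [k -> _] := unlift_some ij; rewrite liftK.
apply: eq_big => [k|k _]; first by rewrite liftK /= eqxx andbT eq_sym neq_lift.
by rewrite mxE liftK nth_word_face.
Qed.

Lemma coface_row_is_linear n (i : 'I_n.+2) : linear (@coface_row R n i).
Proof.
move=> a t u; apply/rowP => j; rewrite !mxE.
by case: unlift => [k|]; rewrite ?mxE // mulr0 addr0.
Qed.

HB.instance Definition _ n (i : 'I_n.+2) :=
  GRing.isLinear.Build R 'rV[R]_n.+1 'rV[R]_n.+2 *:%R (@coface_row R n i)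
    (coface_row_is_linear i).

Lemma map_coface_std_basis n (i : 'I_n.+2) :
  map (coface_row i) (std_basis n) = word_face i (std_basis n.+1).
Proof.
rewrite -[RHS](@map_comb_std_basis _ n); last first.
  rewrite /word_face size_cat size_take size_drop size_std_basis ltn_ord subSS.
  by rewrite subnKC // -ltnS.
by apply: eq_map => t; rewrite -comb_word_face comb_std_basis.
Qed.

Lemma comb_std_simplex n m (w : seq 'rV[R]_n.+1) t :
  words m.+1 (std_simplex R n) w -> std_simplex R m t ->
  std_simplex R n (comb w t).
Proof.
move=> [wm wP] [t0 t1].
have wi (i : 'I_m.+1) : std_simplex R n w`_i by apply: wP; rewrite mem_nth // wm.
split=> [j|].
  rewrite summxE; apply: sumr_ge0 => i _; rewrite mxE mulr_ge0 //.
  exact: (wi i).1.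
under eq_bigr do rewrite summxE.
rewrite exchange_big /= -[RHS]t1; apply: eq_bigr => i _.
under eq_bigr do rewrite mxE.
by rewrite -mulr_sumr (wi i).2 mulr1.
Qed.

Lemma comb_itv m (w : seq R^o) t :
  words m.+1 [set x : R^o | 0 <= x <= 1] w -> std_simplex R m t ->
  0 <= comb w t <= 1.
Proof.
move=> [wm wP] [t0 t1].
have wi (i : 'I_m.+1) : 0 <= w`_i <= 1 by apply: wP; rewrite mem_nth // wm.
apply/andP; split.
  by apply: sumr_ge0 => i _; rewrite mulr_ge0 //; case/andP: (wi i).
rewrite -[leRHS]t1; apply: ler_sum => i _.
by rewrite /GRing.scale /= ler_piMr //; case/andP: (wi i).
Qed.

Lemma comb_ball (V : normedModType R) m (w : seq V) t x e :
  words m.+1 [set y | `|x - y| <= e] w -> std_simplex R m t ->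
  `|x - comb w t| <= e.
Proof.
move=> [wm wP] [t0 t1].
have wi (i : 'I_m.+1) : `|x - w`_i| <= e by apply: wP; rewrite mem_nth // wm.
have -> : x - comb w t = \sum_i t 0 i *: (x - w`_i).
  rewrite -{1}[x]scale1r -t1 scaler_suml -sumrB.
  by apply: eq_bigr => i _; rewrite scalerBr.
apply: (le_trans (ler_norm_sum _ _ _)).
rewrite -[leRHS]mul1r -t1 mulr_suml; apply: ler_sum => i _.
by rewrite normrZ ger0_norm // ler_wpM2l.
Qed.

End Comb.

Section Singular.
Variables (R : realType) (G : zmodType).
Local Notation chain X n := (chain R G X n).
Local Notation singular X n := (singular R X n).

Lemma boundaryU (X : topologicalType) n (s : singular X n.+1) (g : G) :
  boundary (mkmalgU s g : chain X n.+1) =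
  \sum_(i < n.+2) mkmalgU (sing_face i s) g *~ (-1) ^+ i.
Proof.
rewrite (@boundaryEw _ _ _ _ [fset s]%fset) ?msuppU_le // big_seq_fset1.
by rewrite mcoeffU eqxx.
Qed.

Definition within_set (X : topologicalType) n (W : set X) : set (singular X n) :=
  [set s | forall t, W (s t)].

Lemma boundary_supp (X : topologicalType) n (Q : set (singular X n.+1))
    (Q' : set (singular X n)) (c : chain X n.+1) :
  (forall s i, Q s -> Q' (sing_face i s)) -> supp_in Q c -> supp_in Q' (boundary c).
Proof.
move=> QQ'; apply: (additive_supp_in (f := @boundary R G X n)) => s g Qs.
rewrite /= boundaryU; apply: supp_in_sum => i _; apply: supp_in_sign.
by apply: supp_inU; exact: QQ'.
Qed.

Lemma boundary_within (X : topologicalType) n (W : set X) (c : chain X n.+1) :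
  supp_in (within_set W) c -> supp_in (within_set W) (boundary c).
Proof. by apply: boundary_supp => s i Ws t; exact: Ws. Qed.

(* Partial maps between spaces are functional relations: a retraction of an open
   subset of [X] need not extend to [X], and its target may be empty. *)
Section Pushforward.
Variables (X Y : topologicalType) (rho : X -> Y -> Prop).
Hypothesis rho_fun : functional_rel rho.

Definition lift_singular n (s : singular X n) (s' : singular Y n) :=
  forall t, rho (s t) (s' t).

Definition pushforward n : chain X n -> chain Y n := rel_lift (@lift_singular n).
HB.instance Definition _ n := GRing.Additive.on (@pushforward n).

(** The substitute for continuity of a partial map from [U] to [W]: it is required only along
    singular simplices, which is all that chains detect. *)
Definition liftable (U : set X) (W : set Y) := forall n (s : singular X n),
  within_set U s -> exists2 s', lift_singular s s' & within_set W s'.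

Lemma lift_singular_uniq n : functional_rel (@lift_singular n).
Proof. by move=> s s1 s2 h1 h2; apply/continuousEP => t; apply: rho_fun (h1 t) (h2 t). Qed.

Lemma pushforwardU n (s : singular X n) s' g : lift_singular s s' ->
  pushforward (mkmalgU s g) = mkmalgU s' g.
Proof.
by move=> ss'; apply: rel_liftU => // b' /lift_singular_uniq; apply.
Qed.

Lemma pushforward_supp n (U : set X) (W : set Y) (c : chain X n) :
  liftable U W -> supp_in (within_set U) c -> supp_in (within_set W) (pushforward c).
Proof.
move=> lUW; apply: rel_lift_supp => s s' /lUW[s1 ss1 Ws1] ss'.
by rewrite (lift_singular_uniq ss' ss1).
Qed.

Lemma pushforward_boundary n (U : set X) (W : set Y) (c : chain X n.+1) :
  liftable U W -> supp_in (within_set U) c ->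
  boundary (pushforward c) = pushforward (boundary c).
Proof.
move=> lUW.
pose l : {additive chain X n.+1 -> chain Y n} := @boundary R G Y n \o @pushforward n.+1.
pose r : {additive chain X n.+1 -> chain Y n} := @pushforward n \o @boundary R G X n.
apply: (additive_eq_on (f := l) (h := r)) => s g /lUW[s' ss' _]; rewrite /l /r /=.
rewrite (pushforwardU _ ss') !boundaryU raddf_sum; apply: eq_bigr => i _.
rewrite (raddfMz (@pushforward n)) /= (@pushforwardU _ _ (sing_face i s')) //.
by move=> t; exact: ss'.
Qed.

End Pushforward.

Lemma pushforward_comp (X Y Z : topologicalType) (rho1 : X -> Y -> Prop)
    (rho2 : Y -> Z -> Prop) (rho3 : X -> Z -> Prop) n (U : set X) (W : set Y)
    (W' : set Z) (c : chain X n) :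
  functional_rel rho1 -> functional_rel rho2 -> functional_rel rho3 ->
  liftable rho1 U W -> liftable rho2 W W' ->
  (forall x y z, U x -> rho1 x y -> rho2 y z -> rho3 x z) ->
  supp_in (within_set U) c ->
  pushforward rho2 (pushforward rho1 c) = pushforward rho3 c.
Proof.
move=> f1 f2 f3 l1 l2 r123.
pose l : {additive chain X n -> chain Z n} :=
  @pushforward _ _ rho2 n \o @pushforward _ _ rho1 n.
apply: (additive_eq_on (f := l) (h := @pushforward _ _ rho3 n)) => s g Us; rewrite /l /=.
have [s1 ss1 Ws1] := l1 _ _ Us; have [s2 ss2 _] := l2 _ _ Ws1.
have ss3 : lift_singular rho3 s s2 by move=> t; exact: r123 (Us t) (ss1 t) (ss2 t).
by rewrite (pushforwardU f1 _ ss1) (pushforwardU f2 _ ss2) (pushforwardU f3 _ ss3).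
Qed.

Lemma pushforward_id (X : topologicalType) (rho : X -> X -> Prop) n (U : set X)
    (c : chain X n) : functional_rel rho -> (forall x, U x -> rho x x) ->
  supp_in (within_set U) c -> pushforward rho c = c.
Proof.
move=> rho_fun rhoxx.
apply: (additive_eq_on (f := @pushforward _ _ rho n) (h := idfun)) => s g Us /=.
have ss : lift_singular rho s s by move=> t; exact: rhoxx.
by rewrite (pushforwardU rho_fun _ ss).
Qed.

Section PushWords.
Variables (V : lmodType R) (X : topologicalType) (rho : V -> X -> Prop).
Hypothesis rho_fun : functional_rel rho.

Definition lift_word n (w : seq V) (s : singular X n) :=
  size w = n.+1 /\ forall t : std_simplex R n, rho (comb w (val t)) (s t).

Definition push_words n : malg (seq V) G -> chain X n := rel_lift (@lift_word n).
HB.instance Definition _ n := GRing.Additive.on (@push_words n).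

Lemma push_wordsU n (w : seq V) (s : singular X n) g : lift_word w s ->
  push_words n (mkmalgU w g) = mkmalgU s g.
Proof.
move=> [wn ws]; apply: rel_liftU => // s' [_ ws'].
by apply/continuousEP => t; apply: rho_fun (ws' t) (ws t).
Qed.

Lemma lift_word_face n (w : seq V) (s : singular X n.+1) (i : 'I_n.+2) :
  lift_word w s -> lift_word (word_face i w) (sing_face i s).
Proof.
move=> [wn ws]; split=> [|t]; last by rewrite -comb_word_face; exact: ws (coface i t).
have iw : (i < size w)%N by rewrite wn.
by have [] := word_face_words (conj wn (fun _ _ => I) : words n.+2 setT w) iw.
Qed.

Lemma push_words_boundary n (Q : set (seq V)) (c : malg (seq V) G) :
  (forall w, Q w -> exists s : singular X n.+1, lift_word w s) ->
  supp_in Q c ->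
  boundary (push_words n.+1 c) = push_words n (word_boundary c).
Proof.
move=> Ql.
pose l : {additive malg (seq V) G -> chain X n} := @boundary R G X n \o push_words n.+1.
pose r : {additive malg (seq V) G -> chain X n} := push_words n \o @word_boundary G V.
apply: (additive_eq_on (f := l) (h := r)) => w g /Ql[s ws]; rewrite /l /r /=.
rewrite (push_wordsU _ ws) boundaryU word_boundaryU raddf_sum ws.1.
apply: eq_bigr => i _; rewrite (raddfMz (push_words n)) /=.
by rewrite (push_wordsU _ (lift_word_face i ws)).
Qed.

End PushWords.

End Singular.
(** * Prism operators *)

Section SimplexMaps.
Variable R : realType.

Lemma continuous_comb (V : normedModType R) n (w : seq V) :
  continuous (@comb R V n w).
Proof.
apply: continuous_big => [|i _ t]; first exact: add_continuous.
by apply: continuousZr_tmp; exact: coord_continuous.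
Qed.

Lemma continuous_simplex_val n : continuous (val : std_simplex R n -> 'rV[R]_n.+1).
Proof. exact: initial_continuous. Qed.

Lemma simplex_map (n m : nat) (w : seq 'rV[R]_n.+1) :
  words m.+1 (std_simplex R n) w ->
  exists f : continuousType (std_simplex R m) (std_simplex R n),
    forall t, val (f t) = comb w (val t).
Proof.
move=> wP.
have wt (t : std_simplex R m) : comb w (val t) \in std_simplex R n.
  by apply/mem_set; apply: comb_std_simplex => //; exact: set_mem (valP t).
pose f (t : std_simplex R m) : std_simplex R n := SigSub (wt t).
have cf : continuous f.
  apply: continuous_comp_initial => t.
  apply: (@continuous_comp _ _ _ (val : std_simplex R m -> _) (comb w)).
    exact: continuous_simplex_val.
  exact: continuous_comb.
by exists (mkcts cf).
Qed.

End SimplexMaps.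

Section Prism.
Variables (R : realType) (G : zmodType) (X : topologicalType).
Local Notation chain n := (chain R G X n).
Local Notation singular n := (singular R X n).
Local Notation prism_vec n := ('rV[R]_n.+1 * R^o)%type.

Local Notation operator n := {additive malg (seq 'rV[R]_n.+1) G -> malg (seq (prism_vec n)) G}.

Definition prism n : set (prism_vec n) :=
  [set p | std_simplex R n p.1 /\ 0 <= p.2 <= 1].

Lemma comb_pair n m (w : seq (prism_vec n)) (t : 'rV[R]_m.+1) :
  comb w t = (comb (map fst w) t, comb (map snd w) t).
Proof.
rewrite (comb_map (fst : {linear prism_vec n -> _})).
by rewrite (comb_map (snd : {linear prism_vec n -> _})); case: (comb w t).
Qed.

Variable h : X -> R -> X -> Prop.
Hypothesis h_fun : forall r, functional_rel (h ^~ r).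

(** The homotopy along [s], read as a partial map from the vector space around the prism, so that
    affine words in the prism can be pushed into [X]. *)
Definition homotopy_rel n (s : singular n) (p : prism_vec n) (y : X) :=
  exists2 t : std_simplex R n, val t = p.1 & h (s t) p.2 y.

Lemma homotopy_rel_fun n (s : singular n) : functional_rel (homotopy_rel s).
Proof.
move=> p y y' [t tp ty] [t' tp' ty'].
have tt' : t' = t by apply: val_inj; rewrite tp.
by rewrite tt' in ty'; exact: h_fun ty ty'.
Qed.

(** Time varies over the simplex through [b]. This covers every simplex of the prism without putting
    a topology on the product of [X] with an interval. *)
Definition liftable_homotopy (W : set X) :=
  forall n (a : singular n) (b : std_simplex R n -> R^o),
  continuous b -> (forall t, 0 <= b t <= 1) -> within_set W a ->
  exists2 c : singular n, forall t, h (a t) (b t) (c t) & within_set W c.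

Lemma prism_lift (W : set X) n m (s : singular n) w :
  liftable_homotopy W -> within_set W s -> words m.+1 (@prism n) w ->
  exists2 s' : singular m, lift_word (homotopy_rel s) w s' & within_set W s'.
Proof.
move=> hW Ws [wm wP].
have w1P : words m.+1 (std_simplex R n) (map fst w).
  by split=> [|_ /mapP[p /wP [p1 _] ->]//]; rewrite size_map.
have w2P : words m.+1 [set x : R^o | 0 <= x <= 1] (map snd w).
  by split=> [|_ /mapP[p /wP [_ p2] ->]//]; rewrite size_map.
have [f fE] := simplex_map w1P.
pose b (t : std_simplex R m) : R^o := comb (map snd w) (val t).
have cb : continuous b.
  move=> t; apply: (@continuous_comp _ _ _ (val : std_simplex R m -> _) (comb _)).
    exact: continuous_simplex_val.
  exact: continuous_comb.
have b01 t : 0 <= b t <= 1 by apply: comb_itv => //; exact: set_mem (valP t).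
have [c cP Wc] := hW m (s \o f) b cb b01 (fun t => Ws (f t)).
exists c => //; split=> // t.
by exists (f t); rewrite comb_pair /=; [exact: fE|exact: cP].
Qed.

(* An operator on affine chains in the prism, applied to the standard simplex
   and pushed forward along the homotopy. *)
Section PrismOp.
Variables (n p : nat) (Psi : operator n).

Definition prism_op : chain n -> chain p :=
  malg_lift (fun s => push_words (homotopy_rel s) p \o
                      (Psi \o mkmalgU (@std_basis R n))).
HB.instance Definition _ := GRing.Additive.on prism_op.

Lemma prism_opU s g : prism_op (mkmalgU s g) =
  push_words (homotopy_rel s) p (Psi (mkmalgU (@std_basis R n) g)).
Proof. by rewrite /prism_op malg_liftU. Qed.

End PrismOp.

Lemma prism_op_within n p (Psi : operator n) (W : set X) k (c : chain n) :
  liftable_homotopy W ->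
  (forall g, supp_in (words k (@prism n)) (Psi (mkmalgU (@std_basis R n) g))) ->
  supp_in (within_set W) c -> supp_in (within_set W) (prism_op p Psi c).
Proof.
move=> hW Psik; apply: (additive_supp_in (f := prism_op p Psi)) => s g Ws.
rewrite /= prism_opU; apply: rel_lift_supp (Psik g) => w s' [wk wP] [wp ws'].
have wP' : words p.+1 (@prism n) w by split.
have [s1 [_ ws1] Ws1] := prism_lift hW Ws wP'.
suff -> : s' = s1 by [].
by apply/continuousEP => t; exact: homotopy_rel_fun (ws' t) (ws1 t).
Qed.

Lemma boundary_prism_op n p (Psi : operator n) (W : set X) (c : chain n) :
  liftable_homotopy W ->
  (forall g, supp_in (words p.+2 (@prism n)) (Psi (mkmalgU (@std_basis R n) g))) ->
  supp_in (within_set W) c ->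
  boundary (prism_op p.+1 Psi c) = prism_op p (@word_boundary G _ \o Psi) c.
Proof.
move=> hW Psip.
pose l : {additive chain n -> chain p} := @boundary R G X p \o prism_op p.+1 Psi.
apply: (additive_eq_on (f := l) (h := prism_op p (@word_boundary G _ \o Psi))) => s g Ws.
rewrite /l /= !prism_opU.
apply: push_words_boundary (Psip g); first exact: homotopy_rel_fun.
by move=> w wP; have [s' ? _] := prism_lift hW Ws wP; exists s'.
Qed.

Definition prism_coface n (i : 'I_n.+2) (x : prism_vec n) : prism_vec n.+1 :=
  (coface_row i x.1, x.2).

Lemma push_words_coface n p (W : set X) (s : singular n.+1) i c :
  liftable_homotopy W -> within_set W s -> supp_in (words p.+1 (@prism n)) c ->
  push_words (homotopy_rel (sing_face i s)) p c =
  push_words (G := G) (homotopy_rel s) p (map_words (prism_coface i) c).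
Proof.
move=> hW Ws.
pose l := push_words (G := G) (homotopy_rel (sing_face i s)) p.
pose r : {additive _ -> _} :=
  push_words (G := G) (homotopy_rel s) p \o map_words (prism_coface i).
apply: (additive_eq_on (f := l) (h := r)) => w g wP; rewrite /l /r /= map_wordsU.
have Wsi : within_set W (sing_face i s) by move=> t; exact: Ws.
have [s' [wp ws'] _] := prism_lift hW Wsi wP.
rewrite (push_wordsU (homotopy_rel_fun (s:=_)) _ (conj wp ws')).
rewrite (push_wordsU (homotopy_rel_fun (s:=_)) (s := s')) //.
split=> [|t]; first by rewrite size_map.
have [u tu hu] := ws' t; exists (coface i u); last first.
  by move: hu; rewrite !comb_pair /= -!map_comp.
move: tu; rewrite !comb_pair /= => ->.
by rewrite -map_comp -(comb_map (coface_row i)) -map_comp.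
Qed.

(** A face of [s] is [s] restricted to a face of the standard simplex, so compatibility of the
    operators with cofaces moves the boundary from singular chains to words. *)
Lemma prism_op_boundary n p (Psi : operator n) (Psi' : operator n.+1)
    (W : set X) (c : chain n.+1) :
  liftable_homotopy W ->
  (forall g, supp_in (words p.+1 (@prism n)) (Psi (mkmalgU (@std_basis R n) g))) ->
  (forall i u, map_words (@prism_coface n i) (Psi u) = Psi' (map_words (coface_row i) u)) ->
  supp_in (within_set W) c ->
  prism_op p Psi (boundary c) = prism_op p (Psi' \o @word_boundary G _) c.
Proof.
move=> hW Psip PsiE.
pose l : {additive chain n.+1 -> chain p} := prism_op p Psi \o @boundary R G X n.
apply: (additive_eq_on (f := l) (h := prism_op p (Psi' \o @word_boundary G _))) => s g Ws.
rewrite /l /= boundaryU prism_opU /= word_boundaryU size_std_basis !raddf_sum.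
apply: eq_bigr => i _.
rewrite (raddfMz (prism_op p Psi)) /= prism_opU (push_words_coface _ hW Ws) //.
by rewrite PsiE map_wordsU map_coface_std_basis (raddfMz Psi') /= (raddfMz (push_words _ p)).
Qed.

Lemma prism_op_eq n p (Psi Psi' : operator n) (c : chain n) :
  (forall g, Psi (mkmalgU (@std_basis R n) g) = Psi' (mkmalgU (@std_basis R n) g)) ->
  prism_op p Psi c = prism_op p Psi' c.
Proof.
move=> PsiE; apply: (additive_eq (f := prism_op p Psi) (h := prism_op p Psi')) => s g.
by rewrite /= !prism_opU PsiE.
Qed.

Lemma prism_opB n p (Psi Psi' : operator n) (c : chain n) :
  prism_op p (Psi \- Psi') c = prism_op p Psi c - prism_op p Psi' c.
Proof.
pose r : {additive chain n -> chain p} := prism_op p Psi \- prism_op p Psi'.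
apply: (additive_eq (f := prism_op p (Psi \- Psi')) (h := r)) => s g.
by rewrite /r /= !prism_opU /= raddfB.
Qed.

End Prism.

(** * Natural chain homotopies in the prism *)

Section HomotopyTheorem.
Variables (R : realType) (G : zmodType) (X : topologicalType).
Local Notation chain n := (chain R G X n).
Local Notation singular n := (singular R X n).
Local Notation prism_vec n := ('rV[R]_n.+1 * R^o)%type.
Local Notation word_op n := {additive malg (seq 'rV[R]_n.+1) G -> malg (seq (prism_vec n)) G}.

Definition prism_at n (r : R) (x : 'rV[R]_n.+1) : prism_vec n := (x, r).
Definition prism_slice n r : word_op n := map_words (@prism_at n r).
(** The prism is convex, so barycenters at any fixed height would serve as apexes natural under
    cofaces; height 0 is a choice. *)
Definition prism_apex n (w : seq 'rV[R]_n.+1) : prism_vec n := (barycenter w, 0).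

Lemma comb_prism_at n m r (w : seq 'rV[R]_n.+1) (t : std_simplex R m) :
  size w = m.+1 -> comb (map (prism_at r) w) (val t) = (comb w (val t), r).
Proof.
move=> wm; rewrite comb_pair -!map_comp; congr (_, _).
  by congr comb; rewrite -[RHS]map_id; apply: eq_map.
have [_ t1] := set_mem (valP t); rewrite /comb.
under eq_bigr do rewrite (nth_map 0) ?wm //= [_ *: _]/(_ * r).
by rewrite -mulr_suml t1 mul1r.
Qed.

Lemma std_simplex_barycenter n m w :
  words m.+1 (std_simplex R n) w -> std_simplex R n (barycenter w).
Proof.
move=> [wm wP].
have m0 : 0 < m.+1%:R :> R by rewrite ltr0n.
split=> [j|].
  rewrite mxE wm summxE big_seq; apply: mulr_ge0; first by rewrite invr_ge0 ltW.
  by apply: sumr_ge0 => x xw; exact: (wP _ xw).1.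
under eq_bigr do rewrite mxE summxE.
rewrite -mulr_sumr exchange_big /= big_seq.
under eq_bigr => x xw do rewrite (wP _ xw).2.
by rewrite -big_seq big_const_seq count_predT iter_addr_0 wm mulVf ?gt_eqF.
Qed.

Lemma prism_at_prism n r (x : 'rV[R]_n.+1) : 0 <= r <= 1 ->
  std_simplex R n x -> prism (prism_at r x).
Proof. by []. Qed.

Lemma words_std_basis n : words n.+1 (std_simplex R n) (@std_basis R n).
Proof.
split=> [|_ /mapP[i _ ->]]; first exact: size_std_basis.
split=> [j|]; first by rewrite mxE; case: andP.
rewrite (bigD1 i) //= mxE !eqxx big1 ?addr0 // => j ji.
by rewrite mxE (negbTE ji) andbF.
Qed.

Section Homotopy.
Variables (h : X -> R -> X -> Prop) (W : set X).
Hypothesis h_fun : forall r, functional_rel (h ^~ r).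
Hypothesis h0 : forall x, W x -> h x 0 x.
Hypothesis hW : liftable_homotopy h W.

Variable beta : forall n, nat -> word_op n.
Hypothesis beta_boundary : forall n k c,
  word_boundary (beta n k.+1 c) = beta n k (word_boundary c).
Hypothesis beta_nil : forall n g, beta n 0 (mkmalgU [::] g) = mkmalgU [::] g.
Hypothesis beta_words : forall n k (c : malg _ G),
  supp_in (words k (std_simplex R n)) c -> supp_in (words k (@prism R n)) (beta n k c).
Hypothesis beta_coface : forall n k i c,
  map_words (@prism_coface R n i) (beta n k c) = beta n.+1 k (map_words (coface_row i) c).

(** Taking the slice at time 1 for [beta] gives homotopy invariance; taking the subdivision, placed
    in the slice at time 0, compares a chain with its subdivision. *)
Definition prism_homotopy n k : word_op n :=
  cone_homotopy (@prism_apex n) (fun=> prism_slice n 0) (beta n) k.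

Lemma supp_std_basis n (g : G) :
  supp_in (words n.+1 (std_simplex R n)) (mkmalgU (@std_basis R n) g).
Proof. by apply: supp_inU; exact: words_std_basis. Qed.

Lemma prism_slice_words n k r (c : malg (seq 'rV[R]_n.+1) G) : 0 <= r <= 1 ->
  supp_in (words k (std_simplex R n)) c -> supp_in (words k (@prism R n)) (prism_slice n r c).
Proof. by move=> r01; apply: map_words_supp => x; exact: prism_at_prism. Qed.

Lemma itv01_0 : 0 <= (0 : R) <= 1. Proof. by rewrite lexx ler01. Qed.

Lemma prism_homotopy_words n k (c : malg (seq 'rV[R]_n.+1) G) :
  supp_in (words k (std_simplex R n)) c ->
  supp_in (words k.+1 (@prism R n)) (prism_homotopy n k c).
Proof.
move: k c; apply: cone_homotopy_words => [k w wP|k c|k c].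
- by split; [exact: std_simplex_barycenter wP|exact: itv01_0].
- by apply: prism_slice_words; exact: itv01_0.
- exact: beta_words.
Qed.

Lemma prism_slice_coface n i r (c : malg (seq 'rV[R]_n.+1) G) :
  map_words (@prism_coface R n i) (prism_slice n r c) =
  prism_slice n.+1 r (map_words (coface_row i) c).
Proof. by rewrite /prism_slice /= !map_words_comp. Qed.

Lemma prism_homotopy_coface n k i (c : malg (seq 'rV[R]_n.+1) G) :
  map_words (@prism_coface R n i) (prism_homotopy n k c) =
  prism_homotopy n.+1 k (map_words (coface_row i) c).
Proof.
apply: map_cone_homotopy => [w|{}k {}c|{}k {}c].
- by rewrite /prism_coface /prism_apex /= (map_barycenter (coface_row i)).
- exact: prism_slice_coface.
- exact: beta_coface.
Qed.

Lemma prism_homotopy_boundary n k (c : malg (seq 'rV[R]_n.+1) G) :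
  supp_in (words k.+1 (std_simplex R n)) c ->
  word_boundary (prism_homotopy n k.+1 c) =
  prism_slice n 0 c - beta n k.+1 c - prism_homotopy n k (word_boundary c).
Proof.
move=> cP; apply: (@cone_homotopy_boundary G _ _ (@prism_apex n)
  (fun=> prism_slice n 0) (beta n)).
- by move=> j d; rewrite /prism_slice /= map_words_boundary.
- exact: beta_boundary.
- by move=> g; rewrite /prism_slice /= map_wordsU beta_nil.
- by apply: supp_in_sub cP => w [].
Qed.

Lemma prism_slice0 n (c : chain n) : supp_in (within_set W) c ->
  prism_op h n (prism_slice n 0) c = c.
Proof.
apply: (additive_eq_on (f := prism_op h n (prism_slice n 0)) (h := idfun)) => s g Ws.
rewrite /= prism_opU /prism_slice /= map_wordsU.
apply: push_wordsU; first exact: homotopy_rel_fun.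
split=> [|t]; first by rewrite size_map size_std_basis.
rewrite comb_prism_at ?size_std_basis // comb_std_basis; exists t => //=.
exact: h0 (Ws t).
Qed.

(** The remaining term, the homotopy applied to the boundary, disappears for a cycle: by naturality
    in positive degree, and in degree 0 because the homotopy is zero at level 0. *)
Lemma homotopy_cycle n (c : chain n) : is_cycle c -> supp_in (within_set W) c ->
  boundary (prism_op h n.+1 (prism_homotopy n n.+1) c) =
  c - prism_op h n (beta n n.+1) c.
Proof.
move=> cc cW; rewrite (boundary_prism_op h_fun hW) //; last first.
  by move=> g; apply: prism_homotopy_words; exact: supp_std_basis.
rewrite (@prism_op_eq _ _ _ _ _ _ _ (((prism_slice n 0 \- beta n n.+1) : word_op n) \-
   (prism_homotopy n n \o @word_boundary G _))); last first.
  by move=> g; apply: prism_homotopy_boundary; exact: supp_std_basis.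
rewrite !prism_opB (prism_slice0 cW).
suff -> : prism_op h n (prism_homotopy n n \o @word_boundary G _) c = 0 by rewrite subr0.
case: n c cc cW => [|n] c cc cW.
  apply: (additive_eq (h := \0)
    (f := prism_op h 0 (prism_homotopy 0 0 \o @word_boundary G _))).
  by move=> s g /=; rewrite prism_opU /= [prism_homotopy _ _ _]cone_homotopy0 raddf0.
rewrite -(@prism_op_boundary _ _ _ _ h_fun n _ (prism_homotopy n n.+1) _ W) //.
- by move/eqP: cc => ->; rewrite raddf0.
- by move=> g; apply: prism_homotopy_words; exact: supp_std_basis.
- exact: prism_homotopy_coface.
Qed.

Lemma prism_homotopy_within n (c : chain n) : supp_in (within_set W) c ->
  supp_in (within_set W) (prism_op h n.+1 (prism_homotopy n n.+1) c).
Proof.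
apply: prism_op_within => // g.
by apply: prism_homotopy_words; exact: supp_std_basis.
Qed.

End Homotopy.

Lemma pushforward_homotopic (h : X -> R -> X -> Prop) (W : set X) (rho : X -> X -> Prop)
    n (c : chain n) :
  (forall r, functional_rel (h ^~ r)) -> (forall x, W x -> h x 0 x) ->
  liftable_homotopy h W -> functional_rel rho ->
  (forall x y, W x -> h x 1 y -> rho x y) ->
  is_cycle c -> supp_in (within_set W) c ->
  exists2 e : chain n.+1, supp_in (within_set W) e & boundary e = c - pushforward rho c.
Proof.
move=> h_fun h0 hW rho_fun h1 cc cW.
have itv1 : 0 <= (1 : R) <= 1 by rewrite lexx ler01.
pose beta m (_ : nat) := prism_slice m 1.
have b1 m k (d : malg _ G) : word_boundary (beta m k.+1 d) = beta m k (word_boundary d).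
  by rewrite /beta /prism_slice /= map_words_boundary.
have b2 m g : beta m 0 (mkmalgU [::] g) = mkmalgU [::] g.
  by rewrite /beta /prism_slice /= map_wordsU.
have b3 m k (d : malg _ G) : supp_in (words k (std_simplex R m)) d ->
    supp_in (words k (@prism R m)) (beta m k d) by exact: prism_slice_words.
have b4 m k i (d : malg _ G) : map_words (@prism_coface R m i) (beta m k d) =
    beta m.+1 k (map_words (coface_row i) d) by exact: prism_slice_coface.
exists (prism_op h n.+1 (prism_homotopy beta n n.+1) c).
  exact: prism_homotopy_within.
rewrite (homotopy_cycle h_fun h0 hW) //; congr (_ - _).
move: c cW {cc}; apply: (additive_eq_on (f := prism_op h n (beta n n.+1))
   (h := @pushforward R G _ _ rho n)) => s g Ws.
rewrite /= prism_opU /beta /prism_slice /= map_wordsU.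
have wP : words n.+1 (@prism R n) (map (prism_at 1) (@std_basis R n)).
  split; first by rewrite size_map size_std_basis.
  by move=> _ /mapP[x /(words_std_basis n).2 xP ->]; exact: prism_at_prism.
have [s' [wn ws'] _] := prism_lift hW Ws wP.
rewrite (push_wordsU (homotopy_rel_fun h_fun (s := s)) _ (conj wn ws')).
suff ss' : lift_singular rho s s' by rewrite (pushforwardU rho_fun _ ss').
move=> t; apply: h1; first exact: Ws.
have := ws' t; rewrite comb_prism_at ?size_std_basis // comb_std_basis.
by move=> [u /val_inj -> ].
Qed.

End HomotopyTheorem.

(** * Small simplices *)

Section SmallSimplices.
Variables (R : realType) (G : zmodType) (X : topologicalType).
Local Notation chain n := (chain R G X n).
Local Notation singular n := (singular R X n).
Local Notation prism_vec n := ('rV[R]_n.+1 * R^o)%type.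
Local Notation word_op n := {additive malg (seq 'rV[R]_n.+1) G -> malg (seq (prism_vec n)) G}.

(** The stationary homotopy forgets the time coordinate, so prism operators turn into operators on
    singular chains of [X] itself. *)
Definition cst_homotopy (x : X) (r : R) (y : X) := y = x.

Lemma cst_homotopy_fun r : functional_rel (cst_homotopy ^~ r).
Proof. by move=> x y y' -> ->. Qed.

Lemma liftable_cst_homotopy W : liftable_homotopy cst_homotopy W.
Proof. by move=> n a b _ _ Wa; exists a. Qed.

Let push_fun n (s : singular n) := homotopy_rel_fun cst_homotopy_fun (s := s).

Local Notation sdw := (subdivision (@barycenter R _)).

Definition sd_op n k : word_op n := prism_slice G n 0 \o sdw k.

Lemma sd_op_boundary n k c : word_boundary (sd_op n k.+1 c) = sd_op n k (word_boundary c).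
Proof. by rewrite /sd_op /= /prism_slice /= -map_words_boundary subdivision_boundary. Qed.

Lemma sd_op_nil n g : sd_op n 0 (mkmalgU [::] g) = mkmalgU [::] g.
Proof. by rewrite /sd_op /= /prism_slice /= map_wordsU. Qed.

Lemma subdivision_simplex n k (c : malg (seq 'rV[R]_n.+1) G) :
  supp_in (words k (std_simplex R n)) c ->
  supp_in (words k (std_simplex R n)) (sdw k c).
Proof. by apply: subdivision_words => m w; exact: std_simplex_barycenter. Qed.

Lemma sd_op_words n k (c : malg (seq 'rV[R]_n.+1) G) :
  supp_in (words k (std_simplex R n)) c -> supp_in (words k (@prism R n)) (sd_op n k c).
Proof.
by move=> cP; apply: prism_slice_words (itv01_0 R) (subdivision_simplex cP).
Qed.

Lemma sd_op_coface n k i c :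
  map_words (@prism_coface R n i) (sd_op n k c) = sd_op n.+1 k (map_words (coface_row i) c).
Proof.
rewrite /sd_op /= prism_slice_coface (map_subdivision (b' := @barycenter R _)) //.
by move=> w; rewrite (map_barycenter (coface_row i)).
Qed.

Definition sing_subdivision n : chain n -> chain n :=
  prism_op cst_homotopy n (sd_op n n.+1).
HB.instance Definition _ n := GRing.Additive.on (@sing_subdivision n).
Local Notation Sd := (@sing_subdivision _).

Definition fine n (U : set (set X)) : set (singular n) :=
  [set s | exists2 W, U W & within_set W s].

Lemma supp_fine n m (U : set (set X)) (f : {additive chain n -> chain m}) c :
  (forall W d, supp_in (within_set W) d -> supp_in (within_set W) (f d)) ->
  supp_in (@fine n U) c -> supp_in (@fine m U) (f c).
Proof.
move=> fW; apply: additive_supp_in => s g [W UW Ws].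
by apply: supp_in_sub (fW W _ (supp_inU g Ws)) => s' ?; exists W.
Qed.

Lemma sing_subdivision_within n W (c : chain n) :
  supp_in (within_set W) c -> supp_in (within_set W) (Sd c).
Proof.
apply: (prism_op_within cst_homotopy_fun (@liftable_cst_homotopy W)) => g.
exact/sd_op_words/supp_std_basis.
Qed.

Lemma boundary_sing_subdivision n (c : chain n.+1) : boundary (Sd c) = Sd (boundary c).
Proof.
have cT : supp_in (within_set setT) c by [].
rewrite /sing_subdivision.
rewrite (boundary_prism_op cst_homotopy_fun (@liftable_cst_homotopy setT)) //; last first.
  by move=> g; exact/sd_op_words/supp_std_basis.
rewrite (@prism_op_boundary _ _ _ _ cst_homotopy_fun n _ (sd_op n n.+1)
  (sd_op n.+1 n.+1) setT) //.
- by apply: prism_op_eq => g /=; rewrite sd_op_boundary.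
- exact: liftable_cst_homotopy.
- by move=> g; exact/sd_op_words/supp_std_basis.
- exact: sd_op_coface.
Qed.

Lemma push_std_basis n (s : singular n) g :
  push_words (homotopy_rel cst_homotopy s) n
    (prism_slice G n 0 (mkmalgU (@std_basis R n) g)) = mkmalgU s g.
Proof.
by rewrite -prism_opU (prism_slice0 (W := setT) cst_homotopy_fun).
Qed.

(** Every chain is its own image under the operator of the bottom slice, which transfers
    [word_boundaryK] to singular chains. *)
Lemma boundary_boundary n (c : chain n.+2) : boundary (boundary c) = 0.
Proof.
have cT : supp_in (within_set setT) c by [].
rewrite -[c](prism_slice0 (h := cst_homotopy) (W := setT) cst_homotopy_fun) //.
rewrite (boundary_prism_op cst_homotopy_fun (@liftable_cst_homotopy setT)) //; last first.
  by move=> g; apply: prism_slice_words (itv01_0 R) _; exact: supp_std_basis.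
rewrite (boundary_prism_op cst_homotopy_fun (@liftable_cst_homotopy setT)) //; last first.
  move=> g /=; apply: word_boundary_words.
  by apply: prism_slice_words (itv01_0 R) _; exact: supp_std_basis.
apply: (additive_eq (f := prism_op cst_homotopy n _) (h := \0)) => s g /=.
by rewrite prism_opU /= word_boundaryK raddf0.
Qed.

Lemma is_cycle_subdivision n (c : chain n) : is_cycle c -> is_cycle (Sd c).
Proof.
case: n c => [//|n] c /eqP cc; apply/eqP.
by rewrite boundary_sing_subdivision cc raddf0.
Qed.

(** The homotopy only uses points in the image of each simplex, so it stays inside every set of the
    cover; the fineness of [e] is what [boundary_fine] relies on. *)
Lemma sing_subdivision_homotopic n (U : set (set X)) (c : chain n) :
  is_cycle c -> supp_in (@fine n U) c ->
  exists2 e : chain n.+1, supp_in (@fine n.+1 U) e & boundary e = c - Sd c.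
Proof.
move=> cc cU; exists (prism_op cst_homotopy n.+1 (prism_homotopy sd_op n n.+1) c).
  apply: (supp_fine (f := prism_op cst_homotopy n.+1 (prism_homotopy sd_op n n.+1))) cU => W d.
  apply: prism_homotopy_within; [exact: cst_homotopy_fun|exact: liftable_cst_homotopy|].
  exact: sd_op_words.
apply: (@homotopy_cycle _ _ _ _ setT) => //.
- exact: cst_homotopy_fun.
- exact: liftable_cst_homotopy.
- exact: sd_op_boundary.
- exact: sd_op_nil.
- exact: sd_op_words.
- exact: sd_op_coface.
Qed.

Lemma iter_sing_subdivision_homotopic n (U : set (set X)) (c : chain n) m :
  is_cycle c -> supp_in (@fine n U) c ->
  [/\ is_cycle (iter m Sd c), supp_in (@fine n U) (iter m Sd c) &
  exists2 e : chain n.+1, supp_in (@fine n.+1 U) e & boundary e = c - iter m Sd c].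
Proof.
move=> cc cU; elim: m => [|m [mc mU [e eU ec]]].
  by split=> //; exists 0; rewrite ?raddf0 ?subrr //; exact: supp_in0.
split; first exact: is_cycle_subdivision.
  apply: (supp_fine (f := Sd)) mU => W d; exact: sing_subdivision_within.
have [e' e'U e'c] := sing_subdivision_homotopic mc mU.
exists (e + e'); first exact: supp_inD.
by rewrite raddfD /= ec e'c addrA subrK.
Qed.

(** Affine maps commute with barycenters, so subdividing the singular simplices cut out of [s] by
    words amounts to subdividing the words. Iterates are thus computed in the standard simplex,
    where mesh can be measured. *)
Lemma subdivision_push n (s : singular n) (c : malg (seq 'rV[R]_n.+1) G) :
  supp_in (words n.+1 (std_simplex R n)) c ->
  Sd (push_words (homotopy_rel cst_homotopy s) n (prism_slice G n 0 c)) =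
  push_words (homotopy_rel cst_homotopy s) n (prism_slice G n 0 (sdw n.+1 c)).
Proof.
pose P := push_words (G := G) (homotopy_rel cst_homotopy s) n.
pose l : {additive _ -> _} := @sing_subdivision n \o (P \o prism_slice G n 0).
pose r : {additive _ -> _} := P \o (prism_slice G n 0 \o sdw n.+1).
apply: (additive_eq_on (f := l) (h := r)) => w g wP; rewrite /l /r /P /=.
rewrite [map_words _ (mkmalgU w g)]map_wordsU.
have wP' : words n.+1 (@prism R n) (map (prism_at 0) w).
  split; first by rewrite size_map wP.1.
  by move=> _ /mapP[x /wP.2 xP ->]; apply: prism_at_prism => //; exact: itv01_0.
have [s' ws' _] := prism_lift (s := s) (@liftable_cst_homotopy setT) (fun _ => I) wP'.
rewrite (push_wordsU (@push_fun _ s) _ ws') /sing_subdivision prism_opU /sd_op /=.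
rewrite -(@map_comb_std_basis R _ n w wP.1) -(map_wordsU (comb w)).
have sdE (d : malg (seq 'rV[R]_n.+1) G) :
    map_words (comb w) (sdw n.+1 d) = sdw n.+1 (map_words (comb w) d).
  by apply: map_subdivision => v; rewrite (map_barycenter (comb w)).
rewrite -sdE.
have := subdivision_simplex (@supp_std_basis R G n g).
move: (sdw _ _).
pose l' : {additive _ -> _} := push_words (G := G) (homotopy_rel cst_homotopy s') n
  \o map_words (@prism_at R n 0).
pose r' : {additive _ -> _} := P \o (map_words (@prism_at R n 0) \o map_words (@comb R _ n w)).
apply: (additive_eq_on (f := l') (h := r')) => v g' vP; rewrite /l' /r' /P /=.
rewrite !map_wordsU.
have vP' : words n.+1 (@prism R n) (map (prism_at 0) v).
  split; first by rewrite size_map vP.1.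
  by move=> _ /mapP[x /vP.2 xP ->]; apply: prism_at_prism => //; exact: itv01_0.
have [u vu _] := prism_lift (s := s') (@liftable_cst_homotopy setT) (fun _ => I) vP'.
rewrite (push_wordsU (@push_fun _ s') _ vu) (push_wordsU (@push_fun _ s) (s := u)) //.
split=> [|t]; first by rewrite !size_map vP.1.
rewrite comb_prism_at ?size_map ?vP.1 // (comb_map (comb w)).
have := vu.2 t; rewrite comb_prism_at ?vP.1 // => -[t1 /= t1E ->].
have := ws'.2 t1; rewrite comb_prism_at ?wP.1 // => -[t2 /= t2E ->].
by exists t2 => //=; rewrite t2E t1E.
Qed.

Lemma iter_subdivision_push n (s : singular n) g m :
  let w := iter m (sdw n.+1) (mkmalgU (@std_basis R n) g) in
  supp_in (words n.+1 (std_simplex R n)) w /\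
  iter m Sd (mkmalgU s g) =
  push_words (homotopy_rel cst_homotopy s) n (prism_slice G n 0 w).
Proof.
elim: m => [|m [mP IHm]] /=.
  by split; [exact: supp_std_basis|rewrite push_std_basis].
split; first exact: subdivision_simplex.
by rewrite IHm subdivision_push.
Qed.

End SmallSimplices.

(** * Lebesgue numbers and fine chains *)

Section Lebesgue.
Variables (R : realType) (G : zmodType) (X : topologicalType).
Local Notation chain n := (chain R G X n).
Local Notation singular n := (singular R X n).

Lemma std_simplex_norm n (x : 'rV[R]_n.+1) : std_simplex R n x -> `|x| <= 1.
Proof.
move=> [x0 x1]; rewrite [leLHS]mx_normrE; apply/bigmax_leP; split=> //= -[i j] _ /=.
rewrite ord1 ger0_norm // -x1 (bigD1 j) //= lerDl.
by apply: sumr_ge0 => k _; exact: x0.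
Qed.

Lemma closed_std_simplex n : closed (std_simplex R n).
Proof.
have -> : std_simplex R n = (\bigcap_(i in setT) [set t : 'rV[R]_n.+1 | 0 <= t 0 i]) `&`
    [set t | \sum_i t 0 i = 1].
  rewrite predeqE => t; split=> [[t0 t1]|[t0 t1]]; split=> // i; first by move=> _; exact: t0.
  exact: t0.
apply: closedI.
  apply: closed_bigI => i _.
  apply: (@preimage_closed _ _ (fun t : 'rV[R]_n.+1 => t 0 i) [set r | 0 <= r]).
    by move=> t _; exact: coord_continuous.
  exact: closed_ge.
apply: (@preimage_closed _ _ (fun t : 'rV[R]_n.+1 => \sum_i t 0 i) [set r | r = 1]).
  move=> t _; apply: continuous_big => [|i _]; [exact: add_continuous|exact: coord_continuous].
exact: closed_eq.
Qed.

Lemma compact_std_simplex n : compact (std_simplex R n).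
Proof.
apply: bounded_closed_compact; last exact: closed_std_simplex.
exists 1; split=> // M M1 x xP; apply: le_trans (ltW M1).
exact: std_simplex_norm.
Qed.

(** Compactness in its near-covering form. A radius [r] valid at [x] is split in two halves, one for
    moving the center to [x'] and one for the distance from [x'] to [y]; covering then yields a
    uniform radius. *)
Lemma lebesgue_number n (s : singular n) (U : set (set X)) :
  (forall W, U W -> open W) -> \bigcup_(W in U) W = setT ->
  exists2 e : R, 0 < e & forall x : std_simplex R n, exists2 W, U W &
    forall y : std_simplex R n, `|val x - val y| <= e -> W (s y).
Proof.
move=> Uo UT.
pose P (i : R) (x : 'rV[R]_n.+1) := exists2 W, U W &
  forall y : std_simplex R n, `|x - val y| <= i -> W (s y).
have /compact_near_coveringP/(_ R (0^'+) P) cov := @compact_std_simplex n.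
have /cov iP : forall x, std_simplex R n x ->
    \forall x' \near x & i \near (0 : R)^'+, P i x'.
  move=> x xP; have xs : x \in std_simplex R n by exact/mem_set.
  pose x0 : std_simplex R n := SigSub xs.
  have [W UW Wx0] : (\bigcup_(W in U) W) (s x0) by rewrite UT.
  have : nbhs x0 (s @^-1` W).
    apply: (@cts_fun _ _ s x0); apply: open_nbhs_nbhs; split=> //; exact: Uo.
  move=> [_ [[B oB <-] /= Bx0 BW]].
  have /nbhs_ballP[r /= r0 rB] : nbhs x B by apply: open_nbhs_nbhs.
  exists (ball x (r / 2), [set i | i < r / 2]) => /=.
    split; first by apply: nbhsx_ballx; rewrite divr_gt0.
    by apply: nbhs_right_lt; rewrite divr_gt0.
  move=> [x' i] /= [xx' ir]; exists W => // y x'y; apply: BW; apply: rB.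
  rewrite -ball_normE /= in xx' *.
  rewrite (le_lt_trans (ler_distD x' _ _)) // [ltRHS]splitr ltrD //.
  exact: le_lt_trans x'y ir.
near (0 : R)^'+ => i; exists i => // x.
by apply: (near iP i) => //; exact: set_mem (valP x).
Unshelve. all: by end_near. Qed.

Lemma mesh_std_basis n : mesh_le n.+1 2 (@std_basis R n).
Proof.
have [sz Hs] := @words_std_basis R n; split=> // x y /Hs xs /Hs ys.
rewrite (le_trans (ler_normB _ _)) // -[2]/(1 + 1) lerD //; exact: std_simplex_norm.
Qed.

Local Notation Sd := (@sing_subdivision R G X _).

Lemma iter_sing_subdivisionD n m (c d : chain n) :
  iter m Sd (c + d) = iter m Sd c + iter m Sd d.
Proof. by elim: m => //= m ->; rewrite raddfD. Qed.

Lemma iter_sing_subdivision_fine n (U : set (set X)) (c : chain n) :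
  (forall W, U W -> open W) -> \bigcup_(W in U) W = setT ->
  exists m, supp_in (fine U) (iter m Sd c).
Proof.
move=> Uo UT.
(* Fineness from [m] on, rather than at [m], so that a maximum of two thresholds serves a sum. *)
suff [m mP] : exists m, forall k, (m <= k)%N -> supp_in (@fine R X n U) (iter k Sd c).
  by exists m; exact: mP.
move: c (@supp_inT G _ c); apply: supp_ind.
- exists 0%N => k _; elim: k => [|k /= IHk]; first exact: supp_in0.
  apply: (supp_fine (f := Sd)) IHk => W d; exact: sing_subdivision_within.
- move=> c d [m cm] [m' dm]; exists (maxn m m') => k; rewrite geq_max => /andP[mk mk'].
  by rewrite iter_sing_subdivisionD; apply: supp_inD; [exact: cm|exact: dm].
move=> s g _; have [e e0 eP] := lebesgue_number s Uo UT.
pose r : R := n%:R / n.+1%:R.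
have r0 : 0 <= r by rewrite divr_ge0.
have r1 : r < 1 by rewrite ltr_pdivrMr ?ltr0n // mul1r ltr_nat.
have /cvgr0Pnorm_le/(_ _ (divr_gt0 e0 (ltr0Sn R 1)))[m _ me] : (fun k => r ^+ k) @ \oo --> 0.
  by apply: cvg_expr; rewrite ger0_norm.
exists m => k mk; have [wP ->] := iter_subdivision_push s g k.
set w := iter k _ _ in wP *.
have wm : supp_in (mesh_le n.+1 (r ^+ k * 2)) w.
  rewrite /w; elim: k {mk wP w} => [|k IHk] /=.
    by rewrite expr0 mul1r; apply: supp_inU; exact: mesh_std_basis.
  by rewrite exprS -mulrA; apply: subdivision_mesh => //; rewrite mulr_ge0 // exprn_ge0.
have ke : r ^+ k * 2 <= e.
  have := me k mk; rewrite ger0_norm ?exprn_ge0 // ler_pdivlMr //.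
move: w {wP wm} (supp_inI wP wm).
pose f : {additive _ -> _} := push_words (G := G) (homotopy_rel (@cst_homotopy R X) s) n \o
  map_words (@prism_at R n 0).
apply: (additive_supp_in (f := f)) => v g' [[vn vP] [_ vm]]; rewrite /f /= map_wordsU.
(* The first vertex is the center: by convexity a simplex of mesh at most [e] lies in the closed
   ball of radius [e] around any of its vertices. *)
have v0 : v`_0 \in v by rewrite mem_nth // vn.
have v0P : v`_0 \in std_simplex R n by apply/mem_set; exact: vP.
have [W UW Wv] := eP (SigSub v0P).
apply: (@rel_lift_supp _ _ _ _ [set map (prism_at 0) v]); last exact: supp_inU.
move=> _ s' /= -> [_ ss']; exists W => // t.
have [t' t'E ->] := ss' t; apply: Wv; rewrite t'E comb_prism_at //=.
apply: le_trans ke; apply: comb_ball (set_mem (valP t)); split=> // y yv.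
exact: vm.
Qed.

Lemma cycle_fine n (U : set (set X)) (z : chain n) :
  (forall W, U W -> open W) -> \bigcup_(W in U) W = setT -> is_cycle z ->
  exists z' : chain n, [/\ is_cycle z', supp_in (fine U) z' &
    exists e : chain n.+1, boundary e = z - z'].
Proof.
move=> Uo UT zc; have [m zm] := iter_sing_subdivision_fine z Uo UT.
(* With the trivial cover the homotopy lemma asks nothing of [z]. *)
have zT : supp_in (@fine R X n [set setT]) z by move=> s _; exists setT.
have [mc _ [e _ eE]] := iter_sing_subdivision_homotopic m zc zT.
by exists (iter m Sd z); split=> //; exists e.
Qed.

(** Subdividing [c] until it is fine replaces its boundary by a subdivided one; the fine homotopy
    [e] between the two boundaries repairs this. It is the injectivity half of the small-simplices
    theorem. *)
Lemma boundary_fine n (U : set (set X)) (c : chain n.+1) :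
  (forall W, U W -> open W) -> \bigcup_(W in U) W = setT ->
  supp_in (fine U) (boundary c) ->
  exists2 c' : chain n.+1, supp_in (fine U) c' & boundary c' = boundary c.
Proof.
move=> Uo UT cU; have [m cm] := iter_sing_subdivision_fine c Uo UT.
have cc : is_cycle (boundary c).
  by case: n c {cU cm} => [//|n] c; apply/eqP; exact: boundary_boundary.
have [_ _ [e eU eE]] := iter_sing_subdivision_homotopic m cc cU.
exists (iter m Sd c + e); first exact: supp_inD.
suff H : boundary (iter m Sd c) = iter m Sd (boundary c).
  by rewrite raddfD /= eE H addrC subrK.
by elim: m {cm e eU eE} => //= m IHm; rewrite boundary_sing_subdivision IHm.
Qed.

End Lebesgue.

(** * The Mayer-Vietoris sequence *)

Lemma dependent_choice (I : Type) (A : I -> Type) (P : forall i, A i -> Prop) :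
  (forall i, exists a, P i a) -> exists f : forall i, A i, forall i, P i (f i).
Proof.
move=> ex; exists (fun i => sval (cid (ex i))) => i.
exact: svalP (cid (ex i)).
Qed.

(** Compatibility with subtraction reduces single-valuedness to the value at 0. Maps on homology are
    built this way from relations between classes. *)
Lemma additive_of_rel (A B : zmodType) (r : A -> B -> Prop) :
  (forall a, exists b, r a b) ->
  (forall a a' b b', r a b -> r a' b' -> r (a - a') (b - b')) ->
  (forall b, r 0 b -> b = 0) ->
  exists f : {additive A -> B}, forall a b, r a b <-> f a = b.
Proof.
move=> rtot rB r0; have [f fP] := choice rtot.
have rfun a b b' : r a b -> r a b' -> b = b'.
  by move=> ab ab'; apply/eqP; rewrite -subr_eq0; apply/eqP/r0; rewrite -(subrr a); exact: rB.
have fB : zmod_morphism f.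
  by move=> a a'; apply: rfun (fP _) (rB _ _ _ _ (fP a) (fP a')).
pose F : {additive A -> B} := HB.pack f (GRing.isZmodMorphism.Build A B f fB).
exists F => a b; split=> [ab|<-]; [exact: rfun (fP a) ab|exact: fP].
Qed.

Local Open Scope quotient_scope.

(** * Homology classes and the cycles that represent them *)

Section Represents.
Variables (R : realType) (G : zmodType).
Local Notation chain X n := (chain R G X n).
Local Notation H X n := (homology R G X n).

Local Notation hquot X n :=
  (Quotient.quot (GRing.ZmodClosed.clone (sing_cycle R G X n) (@is_boundary R G X n) _)).

(* Relating cycles to classes avoids choosing representatives. *)
Definition represents (X : topologicalType) n (c : chain X n) (x : H X n) :=
  exists2 z : sing_cycle R G X n, val z = c & x = \pi_(hquot X n) z.

Section Basics.
Variables (X : topologicalType) (n : nat).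
Implicit Types (c d : chain X n) (x y : H X n).

Lemma represents_cycle c x : represents c x -> is_cycle c.
Proof. by move=> [z <- _]; exact: valP. Qed.

Lemma class_represented x : exists c, represents c x.
Proof.
by exists (val (repr (x : hquot X n))); exists (repr (x : hquot X n)); rewrite ?reprK.
Qed.

Lemma cycle_represents c : is_cycle c -> exists x, represents c x.
Proof.
move=> cc; pose z : sing_cycle R G X n := Sub c cc.
by exists (\pi_(hquot X n) z); exists z.
Qed.

Lemma representsB c d x y : represents c x -> represents d y ->
  represents (c - d) (x - y).
Proof.
by move=> [z <- ->] [z' <- ->]; exists (z - z'); rewrite raddfB.
Qed.

Lemma represents0 : represents (0 : chain X n) 0.
Proof.
have [x cx] := cycle_represents (is_cycle_zmod_closed R G X n).1.
by rewrite -(subrr (0 : chain X n)) -(subrr x); exact: representsB.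
Qed.

Lemma representsN c x : represents c x -> represents (- c) (- x).
Proof.
move=> cx; rewrite -(sub0r c) -(sub0r x).
by apply: representsB => //; exact: represents0.
Qed.

Lemma representsD c d x y : represents c x -> represents d y ->
  represents (c + d) (x + y).
Proof.
by move=> cx dy; rewrite -(opprK d) -(opprK y); apply: representsB => //; exact: representsN.
Qed.

Lemma represents_eq c d x y : represents c x -> represents d y ->
  x = y <-> exists e : chain X n.+1, boundary e = c - d.
Proof.
move=> [z <- ->] [z' <- ->].
have zz' := Quotient.idealrBE (GRing.ZmodClosed.clone _ (@is_boundary R G X n) _) z z'.
split=> [/eqP|[e eE]].
  rewrite -zz' => /asboolP[e eE]; exists e.
  by rewrite eE raddfB.
by apply/eqP; rewrite -zz'; apply/asboolP; exists e; rewrite eE raddfB.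
Qed.

Lemma represents_homologous c d x (e : chain X n.+1) : represents c x -> is_cycle d ->
  boundary e = c - d -> represents d x.
Proof.
move=> cx dc eE; have [y dy] := cycle_represents dc.
by have -> : x = y by apply/(represents_eq cx dy); exists e.
Qed.

Lemma represents_eq0 c x : represents c x ->
  x = 0 <-> exists e : chain X n.+1, boundary e = c.
Proof. by move=> cx; have := represents_eq cx represents0; rewrite subr0. Qed.

End Basics.

Lemma is_cycle_boundary (X : topologicalType) n (c : chain X n.+1) : is_cycle (boundary c).
Proof. by case: n c => [//|n] c; apply/eqP; exact: boundary_boundary. Qed.

Lemma is_cycle_pushforward (X Y : topologicalType) (rho : X -> Y -> Prop)
    U W n (c : chain X n) :
  functional_rel rho -> liftable R rho U W -> supp_in (within_set U) c ->
  is_cycle c -> is_cycle (pushforward rho c).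
Proof.
case: n c => [//|n] c rf rl cU /eqP cc; apply/eqP.
by rewrite (pushforward_boundary rf rl cU) cc raddf0.
Qed.

Lemma induced_map (X Y : topologicalType) n (phi : {additive chain X n -> chain Y n})
    (phi' : chain X n.+1 -> chain Y n.+1) :
  (forall c, is_cycle c -> is_cycle (phi c)) ->
  (forall c, boundary (phi' c) = phi (boundary c)) ->
  exists F : {additive H X n -> H Y n},
    forall c x, represents c x -> represents (phi c) (F x).
Proof.
move=> phic phib.
pose r (x : H X n) (y : H Y n) := exists2 c, represents c x & represents (phi c) y.
have [||y [c c0 cy]|F FP] := @additive_of_rel _ _ r.
- move=> x; have [c cx] := class_represented x.
  have [y cy] := cycle_represents (phic c (represents_cycle cx)).
  by exists y, c.
- move=> x x' y y' [c cx cy] [c' cx' cy']; exists (c - c'); first exact: representsB.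
  by rewrite raddfB; exact: representsB.
- apply/(represents_eq0 cy); have [+ _] := represents_eq0 c0.
  by move=> /(_ erefl)[e eE]; exists (phi' e); rewrite phib eE.
exists F => c x cx; have [y cy] := cycle_represents (phic c (represents_cycle cx)).
by have -> : F x = y by apply/FP; exists c.
Qed.

End Represents.

Section MayerVietoris.
Variables (R : realType) (G : zmodType).
Local Notation chain X n := (chain R G X n).
Local Notation H X n := (homology R G X n).
Local Notation within W := (supp_in (within_set W)).

Section Retract.
Variables X Y : topologicalType.

(** A deformation retraction of [U] onto a copy of [Y], phrased so that [U] remains a subset of [X]:
    at time 1 the homotopy is the retraction followed by the embedding. *)
Record retract_data (U : set X) (r : X -> Y -> Prop) (i : Y -> X -> Prop) : Prop :=
  RetractData {
    retr_fun : functional_rel r;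
    incl_fun : functional_rel i;
    retr_liftable : liftable R r U setT;
    incl_liftable : liftable R i setT U;
    retr_incl : forall y x y', i y x -> r x y' -> y = y';
    incl_retr : exists h : X -> R -> X -> Prop,
      [/\ forall t, functional_rel (h ^~ t), forall x, U x -> h x 0 x,
          liftable_homotopy h U &
          forall x y x', U x -> r x y -> i y x' -> h x 1 x'] }.

Variables (U : set X) (r : X -> Y -> Prop) (i : Y -> X -> Prop).
Hypothesis D : retract_data U r i.
Local Notation r_ := (pushforward r).
Local Notation i_ := (pushforward i).
Let withinT n (c : chain Y n) : within setT c.
Proof. by []. Qed.

Lemma pushforward_retr_incl n (c : chain Y n) : r_ (i_ c) = c.
Proof.
have eq_fun : functional_rel (@eq Y) by move=> a b b' <-.
have ri y x y' : setT y -> i y x -> r x y' -> y = y'.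
  by move=> _ ix rx; exact: (retr_incl D ix rx).
rewrite (pushforward_comp (incl_fun D) (retr_fun D) eq_fun (incl_liftable D)
  (retr_liftable D) ri (@withinT _ c)).
exact: (pushforward_id eq_fun _ (@withinT _ c)).
Qed.

Lemma pushforward_incl_retr n (c : chain X n) : is_cycle c -> within U c ->
  exists2 e : chain X n.+1, within U e & boundary e = c - i_ (r_ c).
Proof.
move=> cc cU; have [h [hf h0 hl h1]] := incl_retr D.
have [e eU eE] := pushforward_homotopic hf h0 hl (hf 1) (fun x y _ => id) cc cU.
exists e => //; rewrite eE; congr (_ - _); symmetry.
apply: (pushforward_comp (retr_fun D) (incl_fun D) (hf 1)
  (retr_liftable D) (incl_liftable D) _ cU).
exact: h1.
Qed.

Lemma incl_within n (c : chain Y n) : within U (i_ c).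
Proof. exact: (pushforward_supp (incl_fun D) (incl_liftable D) (@withinT _ c)). Qed.

Lemma boundary_incl n (c : chain Y n.+1) : boundary (i_ c) = i_ (boundary c).
Proof. exact: (pushforward_boundary (incl_fun D) (incl_liftable D) (@withinT _ c)). Qed.

Lemma boundary_retr n (c : chain X n.+1) : within U c ->
  boundary (r_ c) = r_ (boundary c).
Proof. exact: (pushforward_boundary (retr_fun D) (retr_liftable D)). Qed.

Lemma is_cycle_incl n (c : chain Y n) : is_cycle c -> is_cycle (i_ c).
Proof. exact: (is_cycle_pushforward (incl_fun D) (incl_liftable D) (@withinT _ c)). Qed.

Lemma is_cycle_retr n (c : chain X n) : within U c -> is_cycle c -> is_cycle (r_ c).
Proof. exact: (is_cycle_pushforward (retr_fun D) (retr_liftable D)). Qed.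

End Retract.

Lemma withinI (X : topologicalType) (U V : set X) n (c : chain X n) :
  within U c -> within V c -> within (U `&` V) c.
Proof. by move=> cU cV; apply: supp_in_sub (supp_inI cU cV) => s [Us Vs] t. Qed.

Lemma within_sub (X : topologicalType) (U V : set X) n (c : chain X n) :
  U `<=` V -> within U c -> within V c.
Proof. by move=> UV; apply: supp_in_sub => s Us t; exact: UV. Qed.

Section Cover.
Variables (X Y1 Y2 Y3 : topologicalType) (U1 U2 : set X).
Variables (r1 : X -> Y1 -> Prop) (i1 : Y1 -> X -> Prop).
Variables (r2 : X -> Y2 -> Prop) (i2 : Y2 -> X -> Prop).
Variables (q : X -> Y3 -> Prop) (s : Y3 -> X -> Prop).
Hypotheses (U1_open : open U1) (U2_open : open U2) (U12_cover : U1 `|` U2 = setT).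
Hypotheses (D1 : retract_data U1 r1 i1) (D2 : retract_data U2 r2 i2).
Hypothesis D3 : retract_data (U1 `&` U2) q s.
(** On the overlap, passing through [Y3] first does not change the retraction. The identity is
    strict, so it holds for chains and not merely up to homology. *)
Hypothesis r1_sq : forall x z x' y, (U1 `&` U2) x ->
  q x z -> s z x' -> r1 x' y -> r1 x y.
Hypothesis r2_sq : forall x z x' y, (U1 `&` U2) x ->
  q x z -> s z x' -> r2 x' y -> r2 x y.

Local Notation r1_ := (pushforward r1).
Local Notation r2_ := (pushforward r2).
Local Notation i1_ := (pushforward i1).
Local Notation i2_ := (pushforward i2).
Local Notation q_ := (pushforward q).
Local Notation s_ := (pushforward s).
Local Notation pf rho n := (@pushforward R G _ _ rho n).
Let cover : set (set X) := [set U1; U2].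

Let cover_open W : cover W -> open W.
Proof. by move=> [->|->]. Qed.

Let bigcup_cover : \bigcup_(W in cover) W = setT.
Proof. by rewrite bigcup_setU !bigcup_set1. Qed.

Let fine_split n (c : chain X n) : supp_in (fine cover) c ->
  exists u v, [/\ c = u + v, within U1 u & within U2 v].
Proof.
move=> cf; apply: supp_inUl; apply: supp_in_sub cf => t [W [->|->] Wt].
  by left.
by right.
Qed.

Let split_fine n (u v : chain X n) : within U1 u -> within U2 v ->
  supp_in (fine cover) (u + v).
Proof.
move=> u1 v2; apply: supp_inD.
  by apply: supp_in_sub u1 => t Ut; exists U1 => //; left.
by apply: supp_in_sub v2 => t Ut; exists U2 => //; right.
Qed.

Let s_within1 n (c : chain Y3 n) : within U1 (s_ c).
Proof. by apply: within_sub _ (incl_within D3 (c := c)) => x []. Qed.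

Let s_within2 n (c : chain Y3 n) : within U2 (s_ c).
Proof. by apply: within_sub _ (incl_within D3 (c := c)) => x []. Qed.

Let retr_sq (Y : topologicalType) (U : set X) (r : X -> Y -> Prop) i n (c : chain X n) :
  retract_data U r i -> U1 `&` U2 `<=` U ->
  (forall x z x' y, (U1 `&` U2) x -> q x z -> s z x' -> r x' y -> r x y) ->
  within (U1 `&` U2) c -> pushforward r (s_ (q_ c)) = pushforward r c.
Proof.
move=> D UU rsq cU.
have sl : liftable R s setT U.
  move=> m t tT; have [t' tt' Ut'] := incl_liftable D3 tT.
  by exists t' => // y; apply: UU; exact: Ut'.
pose rho := fun z y => exists2 x, s z x & r x y.
have rho_fun : functional_rel rho.
  move=> z y y' [x zx xy] [x' zx' xy'].
  by move: zx' xy' => /(incl_fun D3 zx) <-; exact: (retr_fun D xy).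
rewrite (pushforward_comp (incl_fun D3) (retr_fun D) rho_fun sl (retr_liftable D) (W := U)) //.
  have rl : liftable R rho setT setT.
    move=> m t tT; have [t' tt' Ut'] := sl _ _ tT.
    have [t'' tt'' _] := retr_liftable D Ut'.
    by exists t'' => // a; exists (t' a).
  apply: (pushforward_comp (retr_fun D3) rho_fun (retr_fun D) (retr_liftable D3) rl _ cU).
  by move=> x z y Ux xz [x' zx' xy]; exact: rsq xz zx' xy.
by move=> z x y _ zx xy; exists x.
Qed.

(** The usual zigzag: the boundary of one summand of a split cycle lies in the overlap. Keeping the
    splitting as part of a relation defers its ambiguity to [mv_connecting0]. *)
Let mv_connecting n (x : H X n.+1) (y : H Y3 n) := exists u v : chain X n.+1,
  [/\ within U1 u, within U2 v, represents (u + v) x & represents (q_ (boundary u)) y].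

Let split_boundary n (u v : chain X n.+1) : within U1 u -> within U2 v ->
  boundary (u + v) = 0 -> within (U1 `&` U2) (boundary u).
Proof.
move=> u1 v2; rewrite raddfD => /eqP; rewrite addr_eq0 => /eqP uv.
apply: withinI; first exact: boundary_within.
by rewrite uv; apply: supp_inN; exact: boundary_within.
Qed.

(** A bounding chain can be taken fine and split. Subtracting the boundaries of its parts leaves two
    opposite chains, one within [U1] and one within [U2], so both lie in the overlap. *)
Let fine_boundary n (u v : chain X n) (c : chain X n.+1) :
  within U1 u -> within U2 v -> boundary c = u + v ->
  exists c1 c2 : chain X n.+1, [/\ within U1 c1, within U2 c2,
    u - boundary c1 = - (v - boundary c2) & within (U1 `&` U2) (u - boundary c1)].
Proof.
move=> u1 v2 cE.
have [c' c'f c'E] : exists2 c' : chain X n.+1, supp_in (fine cover) c' &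
    boundary c' = boundary c.
  by apply: boundary_fine => //; rewrite cE; exact: split_fine.
have [c1 [c2 [c'12 c1U c2U]]] := fine_split c'f.
have E : u - boundary c1 = - (v - boundary c2).
  apply/eqP; rewrite -addr_eq0 addrACA -cE -c'E c'12 raddfD /= -opprD subrr //.
exists c1, c2; split; [exact: c1U|exact: c2U|exact: E|apply: withinI].
  by apply: supp_inB; [exact: u1|exact: boundary_within].
by rewrite E; apply: supp_inN; apply: supp_inB; [exact: v2|exact: boundary_within].
Qed.

Let mv_connecting_tot n (x : H X n.+1) : exists y, mv_connecting x y.
Proof.
have [z zx] := class_represented x.
have [z' [z'c z'f [e eE]]] := cycle_fine cover_open bigcup_cover (represents_cycle zx).
have [u [v [z'E u1 v2]]] := fine_split z'f.
have z'x := represents_homologous zx z'c eE; rewrite z'E in z'x z'c.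
have bU : within (U1 `&` U2) (boundary u) by apply: split_boundary v2 _ => //; exact/eqP.
have [y qy] := cycle_represents (is_cycle_retr D3 bU (is_cycle_boundary u)).
by exists y, u, v.
Qed.

(** Once corrected by [boundary c1], the chain [u] lies in the overlap with an unchanged boundary,
    so its retraction fills the cycle representing [y]. *)
Let mv_connecting0 n (y : H Y3 n) : mv_connecting (0 : H X n.+1) y -> y = 0.
Proof.
move=> [u [v [u1 v2 uv0 qy]]].
have [+ _] := represents_eq0 uv0; move=> /(_ erefl)[c cE].
have [c1 [c2 [c1U c2U _ wU]]] := fine_boundary u1 v2 cE.
apply/(represents_eq0 qy); exists (q_ (u - boundary c1)).
by rewrite (boundary_retr D3 wU) raddfB /= boundary_boundary subr0.
Qed.

Theorem mayer_vietoris_retracts : exists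
    (f : forall n, {additive H Y3 n -> (H Y1 n * H Y2 n)%type})
    (g : forall n, {additive (H Y1 n * H Y2 n)%type -> H X n})
    (d : forall n, {additive H X n.+1 -> H Y3 n}),
  [/\ forall n, exact_at (f n) (g n), forall n, exact_at (g n.+1) (d n),
      forall n, exact_at (d n) (f n) & range (g 0%N) = setT].
Proof.
have /dependent_choice[i1s i1sP] n : exists F : {additive H Y1 n -> H X n},
    forall c x, represents c x -> represents (i1_ c) (F x).
  apply: (induced_map (phi := pf i1 n) (phi' := pf i1 n.+1)) => c /=.
    exact: (is_cycle_incl D1).
  exact: (boundary_incl D1).
have /dependent_choice[i2s i2sP] n : exists F : {additive H Y2 n -> H X n},
    forall c x, represents c x -> represents (i2_ c) (F x).
  apply: (induced_map (phi := pf i2 n) (phi' := pf i2 n.+1)) => c /=.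
    exact: (is_cycle_incl D2).
  exact: (boundary_incl D2).
have /dependent_choice[p1s p1sP] n : exists F : {additive H Y3 n -> H Y1 n},
    forall c x, represents c x -> represents (r1_ (s_ c)) (F x).
  apply: (induced_map (phi := pf r1 n \o pf s n) (phi' := pf r1 n.+1 \o pf s n.+1)) => c /=.
    by move=> cc; apply: (is_cycle_retr D1) => //; exact: (is_cycle_incl D3 cc).
  by rewrite (boundary_retr D1) // (boundary_incl D3).
have /dependent_choice[p2s p2sP] n : exists F : {additive H Y3 n -> H Y2 n},
    forall c x, represents c x -> represents (r2_ (s_ c)) (F x).
  apply: (induced_map (phi := pf r2 n \o pf s n) (phi' := pf r2 n.+1 \o pf s n.+1)) => c /=.
    by move=> cc; apply: (is_cycle_retr D2) => //; exact: (is_cycle_incl D3 cc).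
  by rewrite (boundary_retr D2) // (boundary_incl D3).
have /dependent_choice[d dP] n : exists F : {additive H X n.+1 -> H Y3 n},
    forall x y, mv_connecting x y <-> F x = y.
  apply: additive_of_rel; [exact: mv_connecting_tot| |exact: mv_connecting0].
  move=> x x' y y' [u [v [u1 v2 uv qu]]] [u' [v' [u1' v2' uv' qu']]].
  exists (u - u'), (v - v'); split; try exact: supp_inB.
    by rewrite addrACA -opprD; exact: representsB.
  by rewrite !raddfB; exact: representsB.
(* The sign on the second component makes the composite with the sum [g] zero. *)
have fB n : zmod_morphism (fun x : H Y3 n => (p1s n x, - p2s n x)).
  by move=> x y; rewrite !raddfB.
pose f n : {additive H Y3 n -> (H Y1 n * H Y2 n)%type} :=
  HB.pack (fun x : H Y3 n => (p1s n x, - p2s n x)) (GRing.isZmodMorphism.Build _ _ _ (@fB n)).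
have gB n : zmod_morphism (fun y : H Y1 n * H Y2 n => i1s n y.1 + i2s n y.2).
  by move=> x y; rewrite !raddfB /= addrACA opprD.
pose g n : {additive (H Y1 n * H Y2 n)%type -> H X n} :=
  HB.pack (fun y : H Y1 n * H Y2 n => i1s n y.1 + i2s n y.2)
    (GRing.isZmodMorphism.Build _ _ _ (@gB n)).
exists f, g, d; split.
- move=> n; rewrite /exact_at predeqE => -[y1 y2]; split=> /=.
    move=> [x _ [<- <-]]; have [c cx] := class_represented x.
    have sc := is_cycle_incl D3 (represents_cycle cx).
    rewrite raddfN; apply/eqP; rewrite subr_eq0; apply/eqP.
    apply/(represents_eq (i1sP _ _ _ (p1sP _ _ _ cx)) (i2sP _ _ _ (p2sP _ _ _ cx))).
    (* Retracting to either side and embedding again gives cycles homologous to [s_ c], hence to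
       each other. *)
    have [e1 _ e1E] := pushforward_incl_retr D1 sc (s_within1 (c := c)).
    have [e2 _ e2E] := pushforward_incl_retr D2 sc (s_within2 (c := c)).
    by exists (e2 - e1); rewrite raddfB /= e1E e2E opprB addrC addrA subrK.
  have [a ay1] := class_represented y1; have [b by2] := class_represented y2.
  have [+ _] := represents_eq0 (representsD (i1sP _ _ _ ay1) (i2sP _ _ _ by2)).
  move=> /[apply] -[c cE].
  have [c1 [c2 [c1U c2U wE wU]]] :=
    fine_boundary (incl_within D1 (c := a)) (incl_within D2 (c := b)) cE.
  (* This cycle of the overlap is homologous to [i1_ a] within [U1] and to [- i2_ b] within [U2];
     its retraction is the preimage. *)
  set w := i1_ a - boundary c1 in wE wU.
  have wc : is_cycle w.
    apply: (is_cycle_zmod_closed R G X n).2; last exact: is_cycle_boundary.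
    exact: (is_cycle_incl D1 (represents_cycle ay1)).
  have [x qx] := cycle_represents (is_cycle_retr D3 wU wc).
  exists x => //; congr (_, _).
    apply/(represents_eq (p1sP _ _ _ qx) ay1); exists (- r1_ c1).
    rewrite (retr_sq D1 (@subIsetl _ _ _) r1_sq wU).
    rewrite raddfN /= (boundary_retr D1 c1U) /w raddfB /= (pushforward_retr_incl D1).
    by rewrite addrAC subrr sub0r.
  apply/(represents_eq (representsN (p2sP _ _ _ qx)) by2); exists (- r2_ c2).
  rewrite (retr_sq D2 (@subIsetr _ _ _) r2_sq wU).
  rewrite raddfN /= (boundary_retr D2 c2U) wE raddfN opprK raddfB /=.
  by rewrite (pushforward_retr_incl D2) addrAC subrr sub0r.
- move=> n; rewrite /exact_at predeqE => x; split=> /=.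
    move=> [[y1 y2] _ <-] /=.
    have [a ay1] := class_represented y1; have [b by2] := class_represented y2.
    apply/dP; exists (i1_ a), (i2_ b); split.
    - exact: (incl_within D1 (c := a)).
    - exact: (incl_within D2 (c := b)).
    - by apply: representsD; [exact: i1sP|exact: i2sP].
    (* A class from the middle group splits into two cycles, so the connecting zigzag starts from a
       zero boundary. *)
    rewrite (boundary_incl D1) (eqP (represents_cycle ay1)) !raddf0.
    exact: represents0.
  move=> /dP[u [v [u1 v2 uv]]] q0; have [+ _] := represents_eq0 q0.
  move=> /(_ erefl)[e eE].
  have uvc := represents_cycle uv; have bU := split_boundary u1 v2 (eqP uvc).
  have [e' e'U e'E] := pushforward_incl_retr D3 (is_cycle_boundary u) bU.
  (* A chain of the overlap with the same boundary as [u]: moving it from [u] to [v] turns both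
     summands into cycles without changing their sum. *)
  set w := e' + s_ e.
  have wU : within (U1 `&` U2) w.
    by apply: supp_inD; [exact: e'U|exact: (incl_within D3 (c := e))].
  have uw : boundary u = boundary w.
    by rewrite /w raddfD /= e'E (boundary_incl D3) eE subrK.
  have uw1 : within U1 (u - w).
    by apply: supp_inB; [exact: u1|exact: (within_sub (@subIsetl _ _ _) wU)].
  have vw2 : within U2 (v + w).
    by apply: supp_inD; [exact: v2|exact: (within_sub (@subIsetr _ _ _) wU)].
  have uwc : is_cycle (u - w) by apply/eqP; rewrite raddfB /= uw subrr.
  have uv0 : boundary u + boundary v = 0 by move/eqP: uvc; rewrite raddfD.
  have vwc : is_cycle (v + w) by apply/eqP; rewrite raddfD /= -uw addrC.
  have [y1 y1E] := cycle_represents (is_cycle_retr D1 uw1 uwc).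
  have [y2 y2E] := cycle_represents (is_cycle_retr D2 vw2 vwc).
  exists (y1, y2); [exact: I|symmetry; rewrite [RHS]/=].
  apply/(represents_eq uv (representsD (i1sP _ _ _ y1E) (i2sP _ _ _ y2E))).
  have [f1 _ f1E] := pushforward_incl_retr D1 uwc uw1.
  have [f2 _ f2E] := pushforward_incl_retr D2 vwc vw2.
  have uvw : u - w + (v + w) = u + v by rewrite addrACA addNr addr0.
  by exists (f1 + f2); rewrite raddfD /= f1E f2E addrACA -opprD uvw.
- move=> n; rewrite /exact_at predeqE => y; split=> /=.
    move=> [x _ xy]; have /dP[u [v [u1 v2 uv qy]]] := xy.
    have bU := split_boundary u1 v2 (eqP (represents_cycle uv)).
    congr (_, _).
      (* The boundary of [u] represents [y] in the overlap, and it is filled by [u] on one side and,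
         up to sign, by [v] on the other. *)
      apply/(represents_eq0 (p1sP _ _ _ qy)); exists (r1_ u).
      by rewrite (retr_sq D1 (@subIsetl _ _ _) r1_sq bU) (boundary_retr D1 u1).
    apply/(represents_eq0 (representsN (p2sP _ _ _ qy))); exists (r2_ v).
    rewrite (retr_sq D2 (@subIsetr _ _ _) r2_sq bU) (boundary_retr D2 v2) -raddfN.
    congr (r2_ _).
    by apply/eqP; rewrite -addr_eq0 addrC -raddfD; exact: represents_cycle uv.
  move=> [p1y p2y]; have [c cy] := class_represented y.
  have [+ _] := represents_eq0 (p1sP _ _ _ cy); move=> /(_ p1y)[a aE].
  have p2y0 : p2s n y = 0 by rewrite -[LHS]opprK p2y oppr0.
  have [+ _] := represents_eq0 (p2sP _ _ _ cy); move=> /(_ p2y0)[b bE].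
  have sc := is_cycle_incl D3 (represents_cycle cy).
  have [e1 e1U e1E] := pushforward_incl_retr D1 sc (s_within1 (c := c)).
  have [e2 e2U e2E] := pushforward_incl_retr D2 sc (s_within2 (c := c)).
  (* The fillings on the two sides are embedded and joined to [s_ c] by the retraction homotopies;
     gluing them along [s_ c] gives the required cycle. *)
  pose u := e1 + i1_ a; pose v := - (e2 + i2_ b).
  have uE : boundary u = s_ c.
    by rewrite /u raddfD /= e1E (boundary_incl D1) aE subrK.
  have vE : boundary v = - s_ c.
    by rewrite /v raddfN raddfD /= e2E (boundary_incl D2) bE subrK.
  have [x xE] : exists x, represents (u + v) x.
    by apply: cycle_represents; apply/eqP; rewrite raddfD /= uE vE subrr.
  exists x; [exact: I|apply/dP; exists u, v; split].
  - by apply: supp_inD; [exact: e1U|exact: (incl_within D1 (c := a))].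
  - by apply: supp_inN; apply: supp_inD; [exact: e2U|exact: (incl_within D2 (c := b))].
  - exact: xE.
  - by rewrite uE (pushforward_retr_incl D3).
- rewrite predeqE => x; split=> // _.
  have [z zx] := class_represented x.
  have [z' [z'c z'f [e eE]]] := cycle_fine cover_open bigcup_cover (represents_cycle zx).
  have z'x := represents_homologous zx z'c eE.
  have [u [v [z'E u1 v2]]] := fine_split z'f.
  (* In degree 0 every chain is a cycle, so any splitting of a fine cycle already gives two
     cycles. *)
  have uc : is_cycle u by [].
  have vc : is_cycle v by [].
  have [y1 y1E] := cycle_represents (is_cycle_retr D1 u1 uc).
  have [y2 y2E] := cycle_represents (is_cycle_retr D2 v2 vc).
  exists (y1, y2); [exact: I|symmetry; rewrite [RHS]/=].
  apply/(represents_eq z'x (representsD (i1sP _ _ _ y1E) (i2sP _ _ _ y2E))).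
  have [f1 _ f1E] := pushforward_incl_retr D1 uc u1.
  have [f2 _ f2E] := pushforward_incl_retr D2 vc v2.
  by exists (f1 + f2); rewrite raddfD /= f1E f2E addrACA -opprD z'E.
Qed.

End Cover.

End MayerVietoris.
(** * Maps out of weak unions *)

Section WeakUnionMaps.
Variables (R : realType) (E E' : topologicalType).
Variables (cells : set (set E)) (cells' : set (set E')).
Local Notation X := (weak_union cells).
Local Notation X' := (weak_union cells').

(** Weak openness for subsets of the ambient space, so that conditions such as positive mass need no
    subtype. *)
Definition trace_open (U : set E) := forall C, cells C ->
  exists2 O : set E, open O & forall x, C x -> (U x <-> O x).

Lemma open_weak_unionE (U : set X) : open U = weak_union_open U.
Proof. by []. Qed.

Lemma trace_open_open (U : set E) : trace_open U -> open ([set x | U (val x)] : set X).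
Proof.
rewrite open_weak_unionE => Uo C /Uo[V oV UV]; exists V => // x Cx; exact: UV.
Qed.

(** One target cell must hold the track of all of [C] inside [U]. The point [x0] restricts this to
    cells that meet [U]: a simplex with no vertex in [A], say, has no target under normalization to
    [A]. *)
Definition cellwise_homotopy (U : set E) (h : E -> R -> E') :=
  forall C x0, cells C -> C x0 -> U x0 -> exists C', [/\ cells' C',
    forall x t, C x -> U x -> 0 <= t <= 1 -> C' (h x t) &
    forall x t, C x -> U x -> 0 <= t <= 1 ->
      h p.1 p.2 @[p --> within [set p | [/\ C p.1, U p.1 & 0 <= p.2 <= 1]]
                         (nbhs (x, t : R^o))] --> h x t].

Lemma val_weak_union (x : X) : exists2 C, cells C & C (val x).
Proof. by have [C CC Cx] := set_mem (valP x); exists C. Qed.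

(* Whitehead's argument: the product of a weak union with a compact interval
   still has the weak topology. *)
Lemma cellwise_homotopy_lift (U : set E) (h : E -> R -> E') (Z : topologicalType)
    (a : Z -> X) (b : Z -> R^o) :
  trace_open U -> cellwise_homotopy U h -> continuous a -> continuous b ->
  (forall z, U (val (a z))) -> (forall z, 0 <= b z <= 1) ->
  exists c : continuousType Z X', forall z, val (c z) = h (val (a z)) (b z).
Proof.
move=> Uo hP ca cb aU b01.
have hin x t : U (val (x : X)) -> 0 <= t <= 1 ->
    h (val x) t \in (\bigcup_(C in cells') C).
  move=> Ux t01; have [C CC Cx] := val_weak_union x.
  have [C' [CC' hC' _]] := hP C (val x) CC Cx Ux.
  by apply/mem_set; exists C' => //; exact: hC'.
pose c z : X' := SigSub (hin (a z) (b z) (aU z) (b01 z)).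
suff cc : continuous c by exists (mkcts cc).
apply/continuousP => W oW; rewrite openE => z0 /= Wz0.
(* The points of the ambient space that come from [W]. *)
pose Wr e' := exists2 y : X', val y = e' & W y.
have [C CC Cz0] := val_weak_union (a z0).
have near_W D x t : cells D -> D x -> U x -> 0 <= t <= 1 -> Wr (h x t) ->
    \forall t' \near (t : R^o) & e \near x, D e -> U e -> 0 <= t' <= 1 -> Wr (h e t').
  move=> DD Dx Ux t01 [y yE Wy]; have [C' [CC' hC' hc]] := hP D x DD Dx Ux.
  have [B oB WB] := oW C' CC'.
  have By : B (h x t) by rewrite -yE; apply/(WB y) => //; rewrite yE; exact: hC'.
  have /(hc x t Dx Ux t01) : nbhs (h x t) B by exact: open_nbhs_nbhs.
  move=> [[P Q] /= [Px Qt] PQ]; exists (Q, P) => //= -[t' e] /= [Qt' Pe] De Ue t'01.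
  have hD : C' (h e t') by exact: hC'.
  have hm : h e t' \in (\bigcup_(C in cells') C) by apply/mem_set; exists C'.
  exists (SigSub hm) => //; apply/(WB (SigSub hm)) => //=.
  exact: (PQ (e, t')).
have Wr0 : Wr (h (val (a z0)) (b z0)) by exists (c z0).
have [d d0 dP] : exists2 d : R, 0 < d & forall t, `|b z0 - t| <= d -> 0 <= t <= 1 ->
    Wr (h (val (a z0)) t).
  have [[P Q] [/= Pb Qa] PQ] := near_W C _ _ CC Cz0 (aU z0) (b01 z0) Wr0.
  have /nbhs_ballP[d /= d0 dP] := Pb.
  exists (d / 2); rewrite ?divr_gt0 // => t bt t01.
  have Pt : P t.
    apply: dP; rewrite -ball_normE /=; apply: le_lt_trans bt _.
    by rewrite ltr_pdivrMr // ltr_pMr // ltr1n.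
  exact: (PQ (t, val (a z0)) (conj Pt (nbhs_singleton Qa)) Cz0 (aU z0) t01).
(* The admissible times within [d] of [b z0]: a compact interval on which the track of [a z0] stays
   in [W]. *)
pose N : set R^o := `[Num.max 0 (b z0 - d), Num.min 1 (b z0 + d)]%classic.
have NP t : N t <-> 0 <= t <= 1 /\ `|b z0 - t| <= d.
  rewrite /N /= in_itv /= ge_max le_min distrC ler_distl.
  split=> [/andP[/andP[-> ->] /andP[-> ->]]//|].
  by move=> [/andP[-> ->] /andP[-> ->]].
have cN : compact N by exact: segment_compact.
(* The tube lemma, applied in each cell with [N] compact, shows that this set has open traces, hence
   is open in the weak topology. *)
pose V := [set e | U e /\ forall t, N t -> Wr (h e t)].
have Vo : trace_open V.
  move=> D DD; exists ([set e | D e -> V e]^°); first exact: open_interior.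
  move=> x Dx; split=> [[Ux Vx]|/interior_subset/(_ Dx)//].
  have /compact_near_coveringP/near_covering_withinP cov := cN.
  pose P e t' := D e -> U e -> Wr (h e t').
  have NW : \forall e \near x, N `<=` P e.
    apply: (cov E (nbhs x) P) => t Nt; have [t01 _] := (NP t).1 Nt.
    apply: filterS (near_W D x t DD Dx Ux t01 (Vx t Nt)) => -[t' e] /= Q Nt' De Ue.
    by apply: Q => //; case/NP: Nt'.
  have [B oB UB] := Uo D DD.
  have xB : nbhs x B by apply: open_nbhs_nbhs; split=> //; apply/(UB x).
  rewrite /interior /=; near=> e => De.
  have Ue : U e by apply/(UB e) => //; near: e.
  split=> // t Nt; move: De Ue; exact: (near NW e).
have near_b : \forall z \near z0, `|b z0 - b z| <= d.
  have nb : nbhs z0 (b @^-1` ball (b z0) d) by exact: cb (nbhsx_ballx (b z0) _ d0).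
  apply: (@filterS _ (nbhs z0) _ _ _ _ nb) => z.
  by rewrite /preimage /= -ball_normE /= => /ltW.
near=> z; rewrite /preimage /=.
have Vz : V (val (a z)).
  near: z; apply: (ca z0 [set x | V (val x)]); apply: open_nbhs_nbhs; split.
    exact: (trace_open_open Vo).
  by split=> // t /NP[t01 bt]; exact: dP.
have Nz : N (b z).
  by apply/NP; split=> //; exact: (near near_b z).
have [y yE Wy] := Vz.2 _ Nz.
suff -> : c z = y by [].
by apply: val_inj; rewrite yE.
Unshelve. all: by end_near. Qed.

End WeakUnionMaps.

Section WeakUnionLifts.
Variable R : realType.

Lemma liftable_cellwise (E E' : topologicalType) (cells : set (set E))
    (cells' : set (set E')) (U : set E) (W : set E') (phi : E -> E') :
  trace_open cells U ->
  (forall C x0, cells C -> C x0 -> U x0 -> exists2 C', cells' C' &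
     forall x, C x -> U x -> [/\ C' (phi x), W (phi x) &
       phi y @[y --> within (C `&` U) (nbhs x)] --> phi x]) ->
  liftable R (fun (x : weak_union cells) (y : weak_union cells') => val y = phi (val x))
    [set x | U (val x)] [set y | W (val y)].
Proof.
move=> Uo phiP n s Us.
(* A map is treated as a homotopy constant in time and evaluated at time 0. *)
have hP : cellwise_homotopy cells cells' U (fun x (t : R) => phi x).
  move=> C x0 CC Cx0 Ux0; have [C' CC' CP] := phiP C x0 CC Cx0 Ux0.
  exists C'; split=> // [x t Cx Ux _|x t Cx Ux _].
    by have [] := CP x Cx Ux.
  have [_ _ phic] := CP x Cx Ux.
  move=> B /phic; rewrite /= /within /= => nB.
  exists ([set y | (C `&` U) y -> B (phi y)], setT); first by split=> //; exact: filterT.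
  by move=> [y r] /= [yB _] [Cy Uy _]; exact: yB.
have [c cE] := cellwise_homotopy_lift Uo hP (@cts_fun _ _ s) (@cst_continuous _ _ (0 : R^o))
  Us (fun=> itv01_0 R).
exists c => [t|t /=]; rewrite cE //.
have [C CC Cx] := val_weak_union (s t).
have [C' _ CP] := phiP C _ CC Cx (Us t).
by have [] := CP _ Cx (Us t).
Qed.

Lemma liftable_homotopy_cellwise (E : topologicalType) (cells : set (set E))
    (U : set E) (h : E -> R -> E) :
  trace_open cells U -> cellwise_homotopy cells cells U h ->
  (forall C x t, cells C -> C x -> U x -> 0 <= t <= 1 -> U (h x t)) ->
  liftable_homotopy
    (fun (x : weak_union cells) (t : R) y => val y = h (val x) t) [set x | U (val x)].
Proof.
move=> Uo hP hU n a b cb b01 Ua.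
have [c cE] := cellwise_homotopy_lift Uo hP (@cts_fun _ _ a) cb Ua b01.
exists c => [t|t /=]; rewrite cE //.
have [C CC Cx] := val_weak_union (a t).
exact: hU CC Cx (Ua t) (b01 t).
Qed.

End WeakUnionLifts.

(** * The join as a union of two open sets *)

Section Barycentric.
Variables (R : realType) (T : choiceType).
Local Notation E := {ptws T -> R}.
Implicit Types (A B : set T) (s : {fset T}) (x y : E).

Lemma cvg_coordwise (Z : Type) (F : set_system Z) (f : Z -> E) (l : E) :
  Filter F -> (forall v, f z v @[z --> F] --> (l v : R)) -> f z @[z --> F] --> l.
Proof.
move=> FF fl; apply/cvg_sup => v A [_ [[B oB <-] /= Bl] BA].
have /fl : nbhs (l v : R) B by exact: open_nbhs_nbhs.
by apply: (@filterS _ F) => z /= Bz; exact: BA.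
Qed.

Lemma cvg_coord x v : y v @[y --> x] --> (x v : R).
Proof. exact: (@proj_continuous T (fun=> R) v x). Qed.

(** The set [A] may be infinite; the sum is meaningful because a point of a realization has finite
    support. *)
Definition mass A x : R := \sum_(v \in A) x v.

Definition trace s A : {fset T} := [fset v in s | v \in A]%fset.

Lemma in_trace s A v : (v \in trace s A) = (v \in s) && (v \in A).
Proof. by rewrite !inE. Qed.

Definition normalize A x : E := fun v => if v \in A then x v / mass A x else 0.

Definition line (t : R) x y : E := fun v => (1 - t) * x v + t * y v.

Definition mass_pos A : set E := [set x | 0 < mass A x].

Lemma massE A s x : (forall v, v \notin s -> x v = 0) ->
  mass A x = \sum_(v <- s | v \in A) x v.
Proof.
move=> xs; rewrite /mass -(@fsbig_widen _ _ _ _ [set` trace s A] A); last 2 first.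
- by move=> v /=; rewrite in_trace => /andP[_ /set_mem].
- move=> v [/= Av /negP]; rewrite in_trace (mem_set Av) andbT => vs.
  exact: xs.
rewrite -fsbig_seq ?fset_uniq // -[RHS]big_filter.
apply: perm_big; apply: uniq_perm; rewrite ?filter_uniq ?fset_uniq // => v.
by rewrite in_trace mem_filter andbC.
Qed.

Section Simplex.
Variables (s : {fset T}) (x : E).
Hypothesis xs : closed_simplex s x.

Lemma closed_simplex_massE A : mass A x = \sum_(v <- s | v \in A) x v.
Proof. by have [_ x0 _] := xs; exact: massE. Qed.

Lemma mass_ge0 A : 0 <= mass A x.
Proof. by rewrite closed_simplex_massE sumr_ge0 // => v _; have [x0 _ _] := xs. Qed.

Lemma mass_disjoint A : (forall v, v \in s -> ~ A v) -> mass A x = 0.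
Proof.
move=> sA; rewrite closed_simplex_massE big_seq_cond big1 // => v /andP[vs /set_mem Av].
by case: (sA v vs).
Qed.

Lemma mass_cover A : (forall v, v \in s -> A v) -> mass A x = 1.
Proof.
move=> sA; have [_ _ <-] := xs; rewrite closed_simplex_massE [LHS]big_seq_cond [RHS]big_seq.
by apply: eq_bigl => v; apply: andb_idr => /sA /mem_set.
Qed.

Lemma massU A B : (forall v, v \in s -> A v \/ B v) -> (forall v, A v -> ~ B v) ->
  mass A x + mass B x = 1.
Proof.
move=> sAB dAB; have [_ _ <-] := xs; rewrite !closed_simplex_massE.
rewrite [RHS](bigID (mem A)) /=; congr (_ + _).
rewrite [LHS]big_seq_cond [RHS]big_seq_cond; apply: eq_bigl => v.
case: (boolP (v \in s)) => //= vs; apply/idP/idP => [/set_mem Bv|/negP Av].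
  by apply/negP => /set_mem Av; exact: dAB Av Bv.
by case: (sAB v vs) => [/mem_set//|/mem_set].
Qed.

Lemma normalize_simplex A : 0 < mass A x -> closed_simplex (trace s A) (normalize A x).
Proof.
move=> A0; have [x0 x0s x1] := xs; split=> [v|v|].
- by rewrite /normalize; case: ifP => // _; rewrite divr_ge0 // ltW.
- rewrite in_trace /normalize; case: ifP => // _; rewrite andbT => /x0s ->.
  by rewrite mul0r.
rewrite -[RHS](mulfV (lt0r_neq0 A0)) [X in _ = X / _]closed_simplex_massE mulr_suml.
have pE : perm_eq [seq v <- s | v \in A] (trace s A).
  apply: uniq_perm; rewrite ?filter_uniq ?fset_uniq // => v.
  by rewrite mem_filter in_trace andbC.
rewrite -[RHS]big_filter (perm_big _ pE) /=.
rewrite [LHS]big_seq [RHS]big_seq; apply: eq_bigr => v.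
by rewrite in_trace /normalize => /andP[_ ->].
Qed.

Lemma trace_neq0 A : 0 < mass A x -> trace s A != fset0.
Proof.
move=> A0; apply/eqP => sA; move: A0; rewrite mass_disjoint ?ltxx // => v vs /mem_set Av.
have : v \in trace s A by rewrite in_trace vs.
by rewrite sA inE.
Qed.

Lemma closed_simplex_sub s' : (s `<=` s')%fset -> closed_simplex s' x.
Proof.
move=> ss'; have [x0 x0s x1] := xs; split=> // [v vs'|].
  by apply: x0s; apply: contra vs'; exact: (fsubsetP ss').
by rewrite -x1; apply/esym/big_fset_incl => // v _; exact: x0s.
Qed.

End Simplex.

Lemma line_simplex s x y t : closed_simplex s x -> closed_simplex s y -> 0 <= t <= 1 ->
  closed_simplex s (line t x y).
Proof.
move=> [x0 x0s x1] [y0 y0s y1] /andP[t0 t1]; split=> [v|v vs|].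
- by rewrite addr_ge0 // mulr_ge0 // subr_ge0.
- by rewrite /line x0s // y0s // !mulr0 addr0.
by rewrite big_split /= -!mulr_sumr x1 y1 !mulr1 subrK.
Qed.

Lemma mass_line A s x y t : closed_simplex s x -> closed_simplex s y -> 0 <= t <= 1 ->
  mass A (line t x y) = (1 - t) * mass A x + t * mass A y.
Proof.
move=> xs ys t01; rewrite !(closed_simplex_massE (s := s)) //; last exact: line_simplex.
by rewrite big_split /= -!mulr_sumr.
Qed.

Lemma onem_half : 1 - 2^-1 = 2^-1 :> R.
Proof. by rewrite {1}[1]splitr div1r addrK. Qed.

(** The end [x] contributes half of its mass to [A] and [y] contributes none, so dividing by one
    half restores [x]. This makes the retraction a strict left inverse of the midpoint embedding. *)
Lemma normalize_line A s1 s2 x y : closed_simplex s1 x -> closed_simplex s2 y ->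
  (forall v, v \in s1 -> A v) -> (forall v, v \in s2 -> ~ A v) ->
  mass A (line 2^-1 x y) = 2^-1 /\ normalize A (line 2^-1 x y) = x.
Proof.
move=> xs ys s1A s2A.
have h01 : 0 <= (2^-1 : R) <= 1 by rewrite invr_ge0 ler0n invf_le1 ?ler1n.
have m2 : mass A (line 2^-1 x y) = 2^-1.
  rewrite (mass_line A (s := (s1 `|` s2)%fset)) //.
  - rewrite (mass_cover xs) // (mass_disjoint ys) // mulr0 addr0 mulr1.
    exact: onem_half.
  - by apply: closed_simplex_sub xs _ _; exact: fsubsetUl.
  - by apply: closed_simplex_sub ys _ _; exact: fsubsetUr.
split=> //; apply/funext => v; rewrite /normalize m2 /line onem_half.
have [_ x0 _] := xs; have [_ y0 _] := ys.
case: ifPn => [/set_mem Av|Av]; last first.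
  by rewrite x0 //; apply: contra Av => /s1A /mem_set.
have -> : y v = 0 by apply: y0; apply/negP => /s2A.
by rewrite mulr0 addr0 mulrAC mulfV ?mul1r // invr_eq0 pnatr_eq0.
Qed.

Lemma lineC x y : line 2^-1 x y = line 2^-1 y x.
Proof. by apply/funext => v; rewrite /line onem_half addrC. Qed.

Lemma cvg_mass (Z : Type) (F : set_system Z) (f : Z -> E) x s A : Filter F ->
  (forall v, f z v @[z --> F] --> (x v : R)) ->
  \sum_(v <- s | v \in A) f z v @[z --> F] --> \sum_(v <- s | v \in A) (x v : R).
Proof.
by move=> FF fx; apply: cvg_big => [|v _]; [exact: add_continuous|exact: fx].
Qed.

(** Total mass need not be continuous for pointwise convergence when [A] is infinite, but on one
    cell it is a finite sum of coordinates. *)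
Lemma trace_open_mass_pos (K : simplicial_complex T) A :
  trace_open [set closed_simplex s | s in K] (mass_pos A).
Proof.
move=> _ [s Ks <-].
exists [set y : E | 0 < \sum_(v <- s | v \in A) y v].
  apply: (@open_comp _ _ (fun y : E => \sum_(v <- s | v \in A) y v) [set r : R | 0 < r]).
    by move=> y _; apply: (@cvg_mass E (nbhs y) id y s A (nbhs_filter y)); exact: cvg_coord.
  exact: open_gt.
by move=> y ys; rewrite /mass_pos /= (closed_simplex_massE ys).
Qed.

Lemma cvg_normalize s A (U : set E) x : closed_simplex s x -> 0 < mass A x ->
  normalize A y @[y --> within (closed_simplex s `&` U) (nbhs x)] --> normalize A x.
Proof.
move=> xs A0; set F := within _ _.
have FF : Filter F by exact: within_filter.
have cF v : y v @[y --> F] --> (x v : R).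
  by apply: (@cvg_within_filter _ _ _ _ (nbhs_filter x)); exact: cvg_coord.
apply: cvg_coordwise => v; rewrite /normalize; case: ifP => [vA|_]; last exact: cvg_cst.
apply: cvgM => //; apply: cvgV; first exact: lt0r_neq0.
have mF : \sum_(u <- s | u \in A) y u @[y --> F] --> mass A x.
  by rewrite (closed_simplex_massE xs); exact: (@cvg_mass E F id x s A FF cF).
apply: cvg_trans mF; apply: near_eq_cvg.
by apply: filterS (withinT _ (nbhs_filter x)) => y [ys _]; rewrite (closed_simplex_massE ys).
Qed.

(** Cells are convex and [phi] maps the part of a cell in [U] back into the cell, so each cell is
    its own target. *)
Lemma cellwise_line (K : simplicial_complex T) (U : set E) (phi : E -> E) :
  (forall s x, simplices K s -> closed_simplex s x -> U x -> closed_simplex s (phi x) /\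
     phi y @[y --> within (closed_simplex s `&` U) (nbhs x)] --> phi x) ->
  cellwise_homotopy [set closed_simplex s | s in K] [set closed_simplex s | s in K]
    U (fun x t => line t x (phi x)).
Proof.
move=> phiP _ x0 [s Ks <-] _ _; exists (closed_simplex s); split.
- by exists s.
- by move=> x t xs Ux t01; apply: line_simplex => //; have [] := phiP s x Ks xs Ux.
move=> x t xs Ux t01; have [_ phic] := phiP s x Ks xs Ux.
set F := within _ _; have FF : Filter F by exact: within_filter.
have fstF : p.1 @[p --> F] --> within (closed_simplex s `&` U) (nbhs x).
  move=> B; rewrite /within /= => nB.
  exists ([set y | (closed_simplex s `&` U) y -> B y], setT).
    by split=> //; exact: filterT.
  by move=> [y r] /= [yB _] [ys Uy _]; exact: yB.
have sndF : p.2 @[p --> F] --> (t : R^o).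
  by apply: (@cvg_within_filter _ _ _ _ (nbhs_filter (x, t : R^o))); exact: cvg_snd.
apply: cvg_coordwise => v; rewrite /line.
apply: cvgD; apply: cvgM => //.
- by apply: cvgB => //; exact: cvg_cst.
- apply: (@cvg_comp _ _ _ (fun p : E * R^o => p.1) (fun y : E => y v : R) _ _ _ fstF).
  by apply: (@cvg_within_filter _ _ _ _ (nbhs_filter x)); exact: cvg_coord.
- apply: (@cvg_comp _ _ _ (fun p : E * R^o => p.1) (fun y : E => phi y v : R) _ _ _ fstF).
  apply: (@cvg_comp _ _ _ phi (fun y : E => y v : R) _ _ _ phic).
  exact: cvg_coord.
Qed.

End Barycentric.

(** * Deformation retractions inside the join *)

Section Retractions.
Variables (R : realType) (T : choiceType).
Local Notation E := {ptws T -> R}.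

Lemma val_functional_rel (X F : Type) (cells : set (set F)) (phi : X -> F) :
  functional_rel (fun (x : X) (y : weak_union cells) => val y = phi x).
Proof. by move=> x y y' yx y'x; apply: val_inj; rewrite yx y'x. Qed.

Lemma trace_in (s : {fset T}) (C : set T) v : v \in trace s C -> C v.
Proof. by rewrite in_trace => /andP[_ /set_mem]. Qed.

Lemma convex_gt0 (a b t : R) : 0 < a -> 0 < b -> 0 <= t <= 1 -> 0 < (1 - t) * a + t * b.
Proof.
move=> a0 b0 /andP[t0]; rewrite le_eqVlt => /predU1P[->|t1].
  by rewrite subrr mul0r add0r mul1r.
by rewrite ltr_wpDr ?mulr_ge0 ?(ltW b0) // mulr_gt0 // subr_gt0.
Qed.

Section FullSubcomplex.
Variables (J L : simplicial_complex T) (A : set T).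
Hypothesis LJ : simplices L `<=` simplices J.
Hypothesis LA : forall s v, simplices L s -> v \in s -> A v.
Hypothesis JL : forall s, simplices J s -> trace s A != fset0 -> simplices L (trace s A).

Let r (x : realization R J) (y : realization R L) := val y = normalize A (val x).
Let i (y : realization R L) (x : realization R J) := val x = val y.

Lemma line_mass_pos s t (x : E) : closed_simplex s x -> mass_pos A x -> 0 <= t <= 1 ->
  mass_pos A (line t x (normalize A x)).
Proof.
move=> xs A0 t01; have ns := normalize_simplex xs A0.
have ts : (trace s A `<=` s)%fset by apply/fsubsetP => v; rewrite in_trace => /andP[].
rewrite /mass_pos /= (mass_line A xs (closed_simplex_sub ns ts) t01).
rewrite (mass_cover ns) => [|v]; last exact: trace_in.
exact: convex_gt0.
Qed.

(** By [JL], normalization carries the part of the cell of [s] with positive mass on [A] into the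
    cell of its trace, a simplex of [L]. The straight line back to [x] keeps the mass positive,
    since its end has mass 1. *)
Lemma retract_full_subcomplex :
  retract_data R [set x : realization R J | mass_pos A (val x)] r i.
Proof.
have ts s : (trace s A `<=` s)%fset by apply/fsubsetP => v; rewrite in_trace => /andP[].
split.
- exact: (val_functional_rel (phi := fun x : realization R J => normalize A (val x))).
- exact: (val_functional_rel (phi := fun y : realization R L => val y : E)).
- apply: (@liftable_cellwise R E E _ _ (mass_pos A) setT (normalize A)).
    exact: trace_open_mass_pos.
  move=> _ x0 [s Js <-] x0s A0; exists (closed_simplex (trace s A)).
    by exists (trace s A) => //; apply: JL => //; exact: (trace_neq0 x0s A0).
  move=> x xs Ax; split=> //; first exact: normalize_simplex.
  exact: cvg_normalize.
- apply: (@liftable_cellwise R E E _ _ setT (mass_pos A) id).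
    by move=> C CC; exists setT => //; exact: openT.
  move=> _ x0 [s Ls <-] _ _; exists (closed_simplex s); first by exists s => //; exact: LJ.
  move=> x xs _; split=> //; last exact: cvg_within.
  by rewrite /mass_pos /= (mass_cover xs) // => v; exact: LA.
- move=> y x y'; rewrite /i /r => xy y'x; apply: val_inj; rewrite y'x xy.
  have [_ [s Ls <-] ys] := val_weak_union y.
  apply/funext => v; rewrite /normalize (mass_cover ys) => [|u]; last exact: LA.
  rewrite divr1; case: ifPn => // vA; have [_ y0 _] := ys; rewrite y0 //.
  by apply: contra vA => /(LA Ls) /mem_set.
exists (fun x t x' => val x' = line t (val x) (normalize A (val x))); split.
- by move=> t; exact: val_functional_rel.
- by move=> x _; apply/funext => v; rewrite /line subr0 mul1r mul0r addr0.
- apply: (@liftable_homotopy_cellwise R E _ (mass_pos A)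
    (fun x t => line t x (normalize A x))).
  + exact: trace_open_mass_pos.
  + apply: cellwise_line => s x Js xs Ax; split; last exact: cvg_normalize.
    exact: closed_simplex_sub (normalize_simplex xs Ax) _ (ts s).
  + by move=> _ x t [s Js <-] xs Ax t01; exact: (line_mass_pos xs Ax t01).
move=> x y x' Ax; rewrite /r /i => yx -> ; rewrite yx.
by apply/funext => v; rewrite /line subrr mul0r add0r mul1r.
Qed.

End FullSubcomplex.

Section Join.
Variables (K M : simplicial_complex T).
Hypothesis disjKM : vertices K `&` vertices M = set0.
Variable S : poset_relation (face_poset K) (face_poset M).
Local Notation J := (relational_join S).
Local Notation A := (vertices K).
Local Notation B := (vertices M).

Lemma simplex_vertex (L : simplicial_complex T) s v : simplices L s -> v \in s -> vertices L v.
Proof.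
move=> Ls vs; rewrite /vertices /=; apply: simplex_sub Ls _ _; first by rewrite fsub1set.
by apply/fset0Pn; exists v; rewrite inE.
Qed.

Lemma vertices_disjoint v : A v -> ~ B v.
Proof. by move=> Av Bv; have : (A `&` B) v by []; rewrite disjKM. Qed.

Lemma trace_sub (s : {fset T}) (C : set T) : (forall v, v \in s -> C v) -> trace s C = s.
Proof.
move=> sC; apply/fsetP => v; rewrite in_trace.
by apply: andb_idr => /sC /mem_set.
Qed.

Lemma trace_disjoint (s : {fset T}) (C : set T) :
  (forall v, v \in s -> ~ C v) -> trace s C = fset0.
Proof.
move=> sC; apply/fsetP => v; rewrite in_trace inE.
by apply/negbTE/negP => /andP[/sC nC /set_mem].
Qed.

Lemma traceU (s s' : {fset T}) (C : set T) :
  trace (s `|` s')%fset C = (trace s C `|` trace s' C)%fset.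
Proof. by apply/fsetP => v; rewrite !inE andb_orl. Qed.

Let KA s : simplices K s -> forall v, v \in s -> A v.
Proof. by move=> + v; exact: simplex_vertex. Qed.
Let MB s : simplices M s -> forall v, v \in s -> B v.
Proof. by move=> + v; exact: simplex_vertex. Qed.
Let KB s : simplices K s -> forall v, v \in s -> ~ B v.
Proof. by move=> Ks v vs; exact: (vertices_disjoint (@KA s Ks v vs)). Qed.
Let MA s : simplices M s -> forall v, v \in s -> ~ A v.
Proof. by move=> Ms v vs Av; exact: (vertices_disjoint Av (@MB s Ms v vs)). Qed.

Arguments KA {s} _ v _.
Arguments MB {s} _ v _.
Arguments KB {s} _ v _.
Arguments MA {s} _ v _.

Let faceK (p : face_poset K) : simplices K (val p). Proof. exact: set_mem (valP p). Qed.
Let faceM (p : face_poset M) : simplices M (val p). Proof. exact: set_mem (valP p). Qed.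

(** A simplex of [K] or of [M] has an empty trace on the other side, so only a mixed simplex
    remains; disjointness recovers the related pair from the union. *)
Lemma join_trace_rel s : simplices J s -> trace s A != fset0 -> trace s B != fset0 ->
  exists2 p, related S p & val p.1 = trace s A /\ val p.2 = trace s B.
Proof.
move=> [[Ks|Ms]|[p Sp <-]] sA sB.
- by move: sB; rewrite (trace_disjoint (KB Ks)) eqxx.
- by move: sA; rewrite (trace_disjoint (MA Ms)) eqxx.
exists p => //; rewrite !traceU (trace_sub (KA (faceK p.1))) (trace_sub (MB (faceM p.2))).
by rewrite (trace_disjoint (KB (faceK p.1))) (trace_disjoint (MA (faceM p.2))) fset0U fsetU0.
Qed.

Lemma join_trace_K s : simplices J s -> trace s A != fset0 -> simplices K (trace s A).
Proof.
move=> [[Ks|Ms]|[p Sp <-]] sA.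
- by rewrite (trace_sub (KA Ks)).
- by move: sA; rewrite (trace_disjoint (MA Ms)) eqxx.
by rewrite traceU (trace_sub (KA (faceK p.1))) (trace_disjoint (MA (faceM p.2))) fsetU0.
Qed.

Lemma join_trace_M s : simplices J s -> trace s B != fset0 -> simplices M (trace s B).
Proof.
move=> [[Ks|Ms]|[p Sp <-]] sB.
- by move: sB; rewrite (trace_disjoint (KB Ks)) eqxx.
- by rewrite (trace_sub (MB Ms)).
by rewrite traceU (trace_disjoint (KB (faceK p.1))) (trace_sub (MB (faceM p.2))) fset0U.
Qed.

Lemma join_cover s v : simplices J s -> v \in s -> A v \/ B v.
Proof.
move=> [[Ks|Ms]|[p Sp <-]].
- by move=> vs; left; exact: (KA Ks).
- by move=> vs; right; exact: (MB Ms).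
by rewrite inE => /orP[vp|vp]; [left; exact: (KA (faceK p.1))|right; exact: (MB (faceM p.2))].
Qed.

Definition mid (p : E * E) : E := line 2^-1 p.1 p.2.

Let U : set E := mass_pos A `&` mass_pos B.

Lemma normalize_mid (y : relational_product R S) :
  [/\ U (mid (val y)), normalize A (mid (val y)) = (val y).1 &
      normalize B (mid (val y)) = (val y).2].
Proof.
have [_ [p Sp <-] [y1 y2]] := val_weak_union y.
have [mA nA] := normalize_line y1 y2 (KA (faceK p.1)) (MA (faceM p.2)).
have [mB nB] := normalize_line y2 y1 (MB (faceM p.2)) (KB (faceK p.1)).
rewrite lineC in mB nB.
by split=> //; split; rewrite /mass_pos /= /mid ?mA ?mB invr_gt0.
Qed.

Definition join_product (x : realization R J) (y : relational_product R S) :=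
  val y = (normalize A (val x), normalize B (val x)).

Definition product_join (y : relational_product R S) (x : realization R J) :=
  val x = mid (val y).

Lemma trace_openI (F : topologicalType) (cells : set (set F)) (V W : set F) :
  trace_open cells V -> trace_open cells W -> trace_open cells (V `&` W).
Proof.
move=> Vo Wo C CC; have [V' oV' VV'] := Vo C CC; have [W' oW' WW'] := Wo C CC.
exists (V' `&` W'); first exact: openI.
by move=> x Cx; split=> -[/(VV' x Cx) ? /(WW' x Cx) ?].
Qed.

Let U_open : trace_open [set closed_simplex s | s in J] U.
Proof. by apply: trace_openI; exact: trace_open_mass_pos. Qed.

Let retr_mid s x : simplices J s -> closed_simplex s x -> U x ->
  closed_simplex s (mid (normalize A x, normalize B x)).
Proof.
move=> Js xs [Ax Bx]; apply: line_simplex.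
- apply: closed_simplex_sub (normalize_simplex xs Ax) _ _.
  by apply/fsubsetP => v; rewrite in_trace => /andP[].
- apply: closed_simplex_sub (normalize_simplex xs Bx) _ _.
  by apply/fsubsetP => v; rewrite in_trace => /andP[].
by rewrite invr_ge0 ler0n invf_le1 ?ler1n.
Qed.

Lemma cvg_mid (Z : Type) (F : set_system Z) (f : Z -> E * E) (l : E * E) : Filter F ->
  (f z).1 @[z --> F] --> l.1 -> (f z).2 @[z --> F] --> l.2 ->
  mid (f z) @[z --> F] --> mid l.
Proof.
move=> FF f1 f2; apply: cvg_coordwise => v; rewrite /mid /line.
apply: cvgD; apply: cvgM; try exact: cvg_cst.
  apply: (@cvg_comp _ _ _ (fun z => (f z).1) (fun y : E => y v : R) _ _ _ f1).
  exact: cvg_coord.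
apply: (@cvg_comp _ _ _ (fun z => (f z).2) (fun y : E => y v : R) _ _ _ f2).
exact: cvg_coord.
Qed.

(** Cells correspond both ways: the cell of a mixed simplex maps to the product of the cells of its
    traces, and midpoints return the product to the cell of the union. *)
Lemma retract_product :
  retract_data R ([set x : realization R J | mass_pos A (val x)] `&`
                  [set x : realization R J | mass_pos B (val x)])
    join_product product_join.
Proof.
have UE : [set x : realization R J | mass_pos A (val x)] `&`
    [set x : realization R J | mass_pos B (val x)] = [set x | U (val x)] by [].
rewrite UE; split.
- exact: (val_functional_rel
    (phi := fun x : realization R J => (normalize A (val x), normalize B (val x)))).
- exact: (val_functional_rel (phi := fun y : relational_product R S => mid (val y))).
- apply: (@liftable_cellwise R E (E * E)%type _ _ U setT
      (fun x => (normalize A x, normalize B x))); first exact: U_open.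
  move=> _ x0 [s Js <-] x0s [Ax0 Bx0].
  have [p Sp [p1 p2]] := join_trace_rel Js (trace_neq0 x0s Ax0) (trace_neq0 x0s Bx0).
  exists (closed_simplex (val p.1) `*` closed_simplex (val p.2)); first by exists p.
  move=> x xs [Ax Bx]; split=> //.
    by split; rewrite ?p1 ?p2 /=; exact: normalize_simplex.
  set F := within _ _; have FF : Filter F by exact: within_filter.
  apply: (@cvg_pair _ _ _ F (nbhs (normalize A x : E)) (nbhs (normalize B x : E)) FF
    (nbhs_filter _) (nbhs_filter _)); exact: cvg_normalize.
- apply: (@liftable_cellwise R (E * E)%type E _ _ setT U mid).
    by move=> C CC; exists setT => //; exact: openT.
  move=> _ x0 [p Sp <-] _ _; exists (closed_simplex (val p.1 `|` val p.2)%fset).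
    by exists (val p.1 `|` val p.2)%fset => //; right; exists p.
  move=> x [x1 x2] _; split.
  + apply: line_simplex.
    * by apply: closed_simplex_sub x1 _ _; exact: fsubsetUl.
    * by apply: closed_simplex_sub x2 _ _; exact: fsubsetUr.
    * by rewrite invr_ge0 ler0n invf_le1 ?ler1n.
  + have xin : x \in \bigcup_(C in [set closed_simplex (val p.1) `*` closed_simplex (val p.2)
             | p in S]) C.
      apply/mem_set; exists (closed_simplex (val p.1) `*` closed_simplex (val p.2)) => //.
      by exists p.
    by have [] := normalize_mid (SigSub xin).
  + apply: (@cvg_within_filter _ _ _ _ (nbhs_filter x)).
    apply: (@cvg_mid _ (nbhs x) id x (nbhs_filter x)); [exact: cvg_fst|exact: cvg_snd].
- move=> y x y'; rewrite /product_join /join_product => xy y'x; apply: val_inj.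
  have [_ nA nB] := normalize_mid y.
  by rewrite y'x xy nA nB; case: (val y).
exists (fun x t x' =>
  val x' = line t (val x) (mid (normalize A (val x), normalize B (val x)))); split.
- by move=> t; exact: val_functional_rel.
- by move=> x _; apply/funext => v; rewrite /line subr0 mul1r mul0r addr0.
- have traceBA s v : v \in trace s B -> ~ A v.
    by rewrite in_trace => /andP[_ /set_mem Bv] Av; exact: vertices_disjoint Av Bv.
  have traceAB s v : v \in trace s A -> ~ B v.
    by rewrite in_trace => /andP[_ /set_mem]; exact: vertices_disjoint.
  apply: (@liftable_homotopy_cellwise R E _ U
    (fun x t => line t x (mid (normalize A x, normalize B x)))).
  + exact: U_open.
  + apply: cellwise_line => s x Js xs Ux; split; first exact: retr_mid.
    by apply: cvg_mid => /=; apply: cvg_normalize => //; case: Ux.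
  + move=> _ x t [s Js <-] xs [Ax Bx] t01; have ms := retr_mid Js xs (conj Ax Bx).
    (* The midpoint has mass one half on both sides, so neither mass can vanish along the line. *)
    have [mA _] := normalize_line (normalize_simplex xs Ax) (normalize_simplex xs Bx)
      (@trace_in s A) (traceBA s).
    have [mB _] := normalize_line (normalize_simplex xs Bx) (normalize_simplex xs Ax)
      (@trace_in s B) (traceAB s).
    rewrite lineC in mB; have h0 : 0 < 2^-1 :> R by rewrite invr_gt0.
    split; rewrite /mass_pos /= (mass_line _ xs ms t01) ?mA ?mB; exact: convex_gt0.
move=> x y x' Ux; rewrite /join_product /product_join => yx ->; rewrite yx.
by apply/funext => v; rewrite /line subrr mul0r add0r mul1r.
Qed.

End Join.

End Retractions.

(* Degrees are natural numbers; as homology vanishes in negative degrees, the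
   last clause is exactness at [H_0] of the relational join. *)
Theorem corollary4p2 (R : realType) (T : choiceType)
    (K M : simplicial_complex T)
    (disjKM : vertices K `&` vertices M = set0)
    (S : poset_relation (face_poset K) (face_poset M))
    (G : zmodType) :
  let H (n : nat) (X : topologicalType) : zmodType := homology R G X n in
  let KM : topologicalType := relational_product R S in
  let J : topologicalType := realization R (relational_join S) in
  exists
    (f : forall n : nat, {additive H n KM ->
           (H n (realization R K) * H n (realization R M))%type})
    (g : forall n : nat, {additive
           (H n (realization R K) * H n (realization R M))%type -> H n J})
    (d : forall n : nat, {additive H n.+1 J -> H n KM}),
  [/\ forall n, exact_at (f n) (g n),
      forall n, exact_at (g n.+1) (d n),
      forall n, exact_at (d n) (f n) &
      range (g 0%N) = setT].
Proof.
move=> H KM J.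
have KJ : simplices K `<=` simplices (relational_join S) by move=> s; left; left.
have MJ : simplices M `<=` simplices (relational_join S) by move=> s; left; right.
have DK := @retract_full_subcomplex R T _ K (vertices K) KJ (@simplex_vertex T K)
  (@join_trace_K T K M disjKM S).
have DM := @retract_full_subcomplex R T _ M (vertices M) MJ (@simplex_vertex T M)
  (@join_trace_M T K M disjKM S).
have DS := @retract_product R T K M disjKM S.
apply: (mayer_vietoris_retracts G _ _ _ DK DM DS).
- exact/trace_open_open/trace_open_mass_pos.
- exact/trace_open_open/trace_open_mass_pos.
- rewrite predeqE => x; split=> // _.
  have [_ [s Js <-] xs] := val_weak_union x.
  (* The two masses add up to 1, so they cannot both vanish and the two open sets cover. *)
  have m1 := massU xs (fun v => join_cover Js (v := v)) (vertices_disjoint disjKM).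
  have := mass_ge0 xs (vertices K); rewrite le_eqVlt => /predU1P[m0|]; last by left.
  have mM : mass (vertices M) (val x) = 1 by rewrite -m1 -m0 add0r.
  by right; rewrite /mass_pos /= mM ltr01.
(* A point of the overlap and its midpoint have the same normalization on each vertex set. *)
- move=> x z x' y [Ax Bx]; rewrite /join_product /product_join => zx x'z ->.
  have [_ nA _] := normalize_mid disjKM z.
  by rewrite x'z nA zx.
- move=> x z x' y [Ax Bx]; rewrite /join_product /product_join => zx x'z ->.
  have [_ _ nB] := normalize_mid disjKM z.
  by rewrite x'z nB zx.
Qed.
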